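(* Let $G$ be a finite group and $\mathcal{H}$ a reduced set of subgroups of $G$ with $\#\mathcal{H}\geq2$ and $d_G(\mathcal{H})=2$. (i) If $\#\mathcal{H}=2$, assume moreover that $\mathcal{H}$ is special and $(G:H)\in4\mathbb{Z}$ for some $H\in\mathcal{H}$. Then the $G$-lattice $J_{G/\mathcal{H}}$ is not quasi-invertible. (ii) If $\#\mathcal{H}\geq3$, assume moreover that $\mathcal{H}$ has a special subset $\mathcal{H}_0$ with $\#\mathcal{H}_0\geq3$. Then the $G$-lattice $J_{G/\mathcal{H}}$ is not quasi-invertible.
   Context: A $G$-lattice is a finitely generated free abelian group with a left $G$-action; $M^\circ:=\mathrm{Hom}_{\mathbb{Z}}(M,\mathbb{Z})$ with $(gf)(x)=f(g^{-1}x)$. Permutation: has a $\mathbb{Z}$-basis permuted by $G$; quasi-permutation: there is an exact sequence $0\to M\to R\to F\to0$ with $R,F$ permutation; quasi-invertible: direct summand of a quasi-permutation lattice. For a set $\mathcal{H}$ of subgroups, $I_{G/\mathcal{H}}:=\ker(\bigoplus_{H\in\mathcal{H}}\mathbb{Z}[G/H]\to\mathbb{Z})$ (sum of augmentation maps) and $J_{G/\mathcal{H}}:=I_{G/\mathcal{H}}^\circ$. $d_G(\mathcal{H}):=\gcd((G:H)\mid H\in\mathcal{H})$. A set of subgroups is reduced if no element is contained in a different element. $N^G(H):=\bigcap_{g}gHg^{-1}$. A set $\mathcal{H}$ of subgroups of $G$ is special if $G\notin\mathcal{H}$, $\#\mathcal{H}\geq2$, and for all distinct $H,H'\in\mathcal{H}$,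 $N^G(H)H'=G$ or $N^G(H')H=G$. *)

(* Defs.v *)
(* G-lattices are modelled concretely as int^n (column vectors)
   with a left G-action g . v = A g *m v. *)
From mathcomp Require Import all_boot all_order all_algebra all_fingroup.
Set Implicit Arguments. Unset Strict Implicit. Unset Printing Implicit Defensive.
Import GRing.Theory.
Local Open Scope ring_scope.

Section GLattices.
Variable gT : finGroupType.
Variable G : {group gT}.

Definition is_glat n (A : gT -> 'M[int]_n) : Prop :=
  A 1%g = 1%:M /\ {in G &, forall x y, A (x * y)%g = A x *m A y}.

Definition gmap n m (A : gT -> 'M[int]_n) (B : gT -> 'M[int]_m)
  (F : 'M[int]_(m, n)) : Prop :=
  forall g, g \in G -> F *m A g = B g *m F.

(* dual lattice M° = Hom(M, Z) with (g f)(x) = f (g^-1 x), in the dual basis *)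
Definition dual_lat n (A : gT -> 'M[int]_n) : gT -> 'M[int]_n :=
  fun g => (A g^-1%g)^T.

(* permutation lattice: some Z-basis (the columns of P) is permuted by G *)
Definition is_perm_lat n (A : gT -> 'M[int]_n) : Prop :=
  exists P : 'M[int]_n, P \in unitmx /\
    forall g, g \in G -> is_perm_mx (invmx P *m A g *m P).

Definition mx_injective n m (F : 'M[int]_(m, n)) : Prop :=
  forall v : 'cV[int]_n, F *m v = 0 -> v = 0.

Definition mx_surjective n m (F : 'M[int]_(m, n)) : Prop :=
  forall w : 'cV[int]_m, exists v : 'cV[int]_n, F *m v = w.

Definition is_quasi_perm_lat n (A : gT -> 'M[int]_n) : Prop :=
  exists r f (B : gT -> 'M[int]_r) (C : gT -> 'M[int]_f)
         (i : 'M[int]_(r, n)) (p : 'M[int]_(f, r)),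
    [/\ is_glat B, is_glat C, is_perm_lat B & is_perm_lat C] /\
    [/\ gmap A B i, gmap B C p, mx_injective i, mx_surjective p &
        forall v : 'cV[int]_r, p *m v = 0 <-> exists u, v = i *m u].

Definition is_summand n N (A : gT -> 'M[int]_n) (B : gT -> 'M[int]_N) : Prop :=
  exists n' (A' : gT -> 'M[int]_n') (F : 'M[int]_(N, n + n'))
         (F' : 'M[int]_(n + n', N)),
    [/\ is_glat A', F *m F' = 1%:M, F' *m F = 1%:M &
        gmap (fun g => block_mx (A g) 0 0 (A' g)) B F].

Definition is_quasi_invertible n (A : gT -> 'M[int]_n) : Prop :=
  exists N (B : gT -> 'M[int]_N),
    [/\ is_glat B, is_quasi_perm_lat B & is_summand A B].

(* The Z-basis of (+)_{H in HH} Z[G/H]: pairs (H, xH) *)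
Definition coset_basis (HH : {set {group gT}}) : {set ({group gT} * {set gT})} :=
  [set (H, lcoset (gval H) x) | H : {group gT} in HH, x : gT in G].

(* the permutation representation on (+)_{H in HH} Z[G/H]:
   g . e_(H, xH) = e_(H, gxH) *)
Definition coset_rep (HH : {set {group gT}}) : gT -> 'M[int]_#|coset_basis HH| :=
  fun g => \matrix_(i, j)
    (((enum_val i).1 == (enum_val j).1) &&
     ((enum_val i).2 == lcoset (enum_val j).2 g) : nat)%:Z.

Definition aug_map (HH : {set {group gT}}) : 'M[int]_(1, #|coset_basis HH|) :=
  const_mx 1.

Definition dG (HH : {set {group gT}}) : nat :=
  \big[gcdn/0%N]_(H in HH) #|G : H|%g.

Definition reduced (HH : {set {group gT}}) : Prop :=
  forall H H', H \in HH -> H' \in HH -> H \subset H' -> H = H'.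

Definition coreG (H : {set gT}) : {set gT} := \bigcap_(g in G) (H :^ g)%g.

Definition special (HH : {set {group gT}}) : Prop :=
  [/\ G \notin HH, (2 <= #|HH|)%N &
      forall H H', H \in HH -> H' \in HH -> H != H' ->
        (coreG H * H')%g = G :> {set gT} \/ (coreG H' * H)%g = G :> {set gT}].

End GLattices.

(* Main.v *)
Require Import Defs.
From mathcomp Require Import all_boot all_order all_algebra all_fingroup.
From mathcomp Require Import pgroup sylow gseries.
From mathcomp Require maximal.
Set Implicit Arguments. Unset Strict Implicit. Unset Printing Implicit Defensive.
Import GRing.Theory Num.Theory.
Local Open Scope ring_scope.

(** If [J = I°] is quasi-invertible then, dually, [I] is a direct summand of a
quotient [R/F] of permutation lattices, also after restriction to a Sylow
2-subgroup [P] of [G]. Let [Y] be a summand of [R/F] as a [P]-lattice, let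
[y, e] be elements of [Y] with [e] fixed by [P] and [N_P y = m e], and suppose
that [e - tr_(P/K) y] lies in [I_K Y] for all [K <= P] of order [m]. Lift [e]
to [R^P] (by [H^1(P, F) = 0]) and [y] to [r] in [R]. Then [m e - N_P r] is a
[P]-fixed element of [F] which is a norm from every [K] of order [m]; as [F] is
a permutation lattice, its coefficient at a basis element [x] is divisible by
[min(m, |P_x|)], so that [r] can be changed by an element of [F] to have
[N_P r] in [m R]. Hence [y] lies in
[I_P Y + 2 Y + sum of the Y^S for S <= P of order >= m].

This is violated in the augmentation kernel [Y] of [Z[X]], [X] the union of the
[G/H]: since the gcd of the indices is 2, [P] fixes no point of [X] and some
[x1] has a stabilizer [M1] of index 2. Choose [x2] with stabilizer of maximal
order [m] among those not contained in [M1], and take [y = x2 - x1],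
[e = [P x2] - (|P x2|/2) [P x1]]. The sum mod 2 of the coefficients at the
points whose stabilizer is in [M1] vanishes on [I_P Y], on [2 Y] and on all the
[Y^S], but not at [y]. The conditions on [e] and [y] hold as soon as 4 divides
[|P x2|] or some stabilizer is contained neither in [M1] nor in the stabilizer
of [x2]; this follows from speciality, because if [N^G(H) H' = G] then [P] is
the product of any stabilizer on [G/H] with any stabilizer on [G/H'] that is
a Sylow subgroup of a conjugate of [H']. *)

(** * Integer matrices: sections of surjections, permutation matrices *)

Lemma mx_surjective_section m n (p : 'M[int]_(m, n)) :
  mx_surjective p -> exists s, p *m s = 1%:M.
Proof.
move=> surj_p; have [s Ds] := fin_all_exists (fun j => surj_p (col j 1%:M)).
exists (\matrix_(i, j) s j i 0); apply/matrixP=> i j.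
have /matrixP/(_ i 0) := Ds j; rewrite !mxE => <-.
by apply: eq_bigr => k _; rewrite !mxE.
Qed.

Lemma mul_perm_mxE m n (s : 'S_m) (v : 'M[int]_(m, n)) i j :
  (perm_mx s *m v) i j = v (s i) j.
Proof. by rewrite -row_permE mxE. Qed.

Lemma perm_mx_inj n : injective (@perm_mx int n).
Proof.
move=> s t eq_st; apply/permP=> i.
have /matrixP/(_ i (s i)) := eq_st; rewrite !mxE eqxx eq_sym.
by case: eqP => // ->.
Qed.

(** * Dualizing a quasi-invertible structure *)

Section Resolution.

Variables (gT : finGroupType) (P : {group gT}).

(* The dual of a quasi-invertible structure: the lattice [A] is a retract
   (via [rho], [sig]) of the cokernel of an injection of permutation lattices
   [j], whose bases are permuted through [c] and [s]. *)
Definition perm_resolution n (A : gT -> 'M[int]_n) : Prop :=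
  exists r f N (B : gT -> 'M[int]_N) (s : gT -> 'S_r) (c : gT -> 'S_f)
         (q : 'M[int]_(N, r)) (j : 'M[int]_(r, f))
         (sig : 'M[int]_(N, n)) (rho : 'M[int]_(n, N)),
  [/\ {in P &, {morph s : x y / (x * y)%g}}
    & {in P &, {morph c : x y / (x * y)%g}}] /\
  [/\ gmap P (fun g => perm_mx (s g)) B q,
      gmap P (fun g => perm_mx (c g)) (fun g => perm_mx (s g)) j,
      mx_surjective q, mx_injective j
    & forall v : 'cV_r, q *m v = 0 <-> exists u, v = j *m u] /\
  [/\ gmap P A B sig, gmap P B A rho & rho *m sig = 1%:M].

Lemma glat_perm_basis n (B : gT -> 'M[int]_n) :
    is_glat P B -> is_perm_lat P B ->
  exists (U : 'M[int]_n) (s : gT -> 'S_n),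
    [/\ U \in unitmx, {in P &, {morph s : x y / (x * y)%g}}
      & forall g, g \in P -> invmx U *m B g *m U = perm_mx (s g)].
Proof.
case=> _ BM [U [uU permB]].
have /fin_all_exists[s Ds]: forall g, exists t : 'S_n,
    g \in P -> invmx U *m B g *m U = perm_mx t.
  move=> g; have [/permB/is_perm_mxP[t ->]|_] := boolP (g \in P).
    by exists t.
  by exists 1%g.
exists U, s; split=> // x y Px Py; apply: perm_mx_inj.
rewrite perm_mxM -!Ds ?groupM // BM //.
by rewrite -!mulmxA (mulmxA U) mulmxV // mul1mx.
Qed.

(** Permutation matrices are orthogonal, so a permutation lattice is its own dual. *)
Lemma tr_morph_perm n (s : gT -> 'S_n) g :
  {in P &, {morph s : x y / (x * y)%g}} -> g \in P ->
  (perm_mx (s g^-1%g))^T = perm_mx (s g) :> 'M[int]_n.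
Proof.
move=> sM Pg; rewrite tr_perm_mx; congr perm_mx.
apply: (mulgI (s g^-1%g)); rewrite mulgV -sM ?groupV // mulVg.
by apply: (mulgI (s 1%g)); rewrite -sM // !mulg1.
Qed.

(** The sequence 0 -> N -> R -> F -> 0 of the quasi-permutation lattice splits over the integers, so
    its transpose is exact again. The splitting is not equivariant, but exactness does not see the
    action. Transposing the decomposition of N with summand [dual_lat A] makes [A] a retract of the
    dual of N. *)
Lemma quasi_invertible_resolution n (A : gT -> 'M[int]_n) :
  is_quasi_invertible P (dual_lat A) -> perm_resolution A.
Proof.
case=> N [B [_ [r [f [R [F [i [p [[gR gF pR pF] [iE pE inj_i surj_p ex]]]]]]]]]].
case=> n' [A' [E [E' [_ EE' E'E Emap]]]].
have [U [s [uU sM Us]]] := glat_perm_basis gR pR.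
have [V [c [uV cM Vc]]] := glat_perm_basis gF pF.
have [z pz] := mx_surjective_section surj_p.
have pi0: p *m i = 0.
  apply/matrixP=> a b; have /matrixP/(_ a 0): p *m (i *m col b 1%:M) = 0.
    by apply/ex; exists (col b 1%:M).
  by rewrite mulmxA colE mul1mx -colE !mxE.
(* [z] and [u] split the sequence: [z *m p + i *m u = 1%:M]. *)
have [u Du]: exists u, 1%:M - z *m p = i *m u.
  have h b : exists w : 'cV_N, col b (1%:M - z *m p) = i *m w.
    apply/ex; rewrite colE !mulmxA mulmxBr mulmx1 mulmxA pz mul1mx subrr.
    by rewrite mul0mx.
  have [w Dw] := fin_all_exists h; exists (\matrix_(a, b) w b a 0).
  apply/matrixP=> a b; have /matrixP/(_ a 0) := Dw b; rewrite !mxE => ->.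
  by apply: eq_bigr => k _; rewrite !mxE.
have ui: u *m i = 1%:M.
  have h: i *m (u *m i - 1%:M) = 0.
    rewrite mulmxBr mulmxA -Du mulmxBl mul1mx -mulmxA pi0 mulmx0 subr0 mulmx1.
    by rewrite subrr.
  apply/eqP; rewrite -subr_eq0; apply/eqP/matrixP=> a b.
  have /matrixP/(_ a 0): col b (u *m i - 1%:M) = 0.
    by apply: inj_i; rewrite colE mulmxA h mul0mx.
  by rewrite !mxE.
have [uUt uVt] : U^T \in unitmx /\ V^T \in unitmx by rewrite !unitmx_tr.
have trU g : g \in P -> (R g^-1%g)^T *m invmx U^T = invmx U^T *m perm_mx (s g).
  move=> Pg; rewrite -(tr_morph_perm sM Pg) -Us ?groupV //.
  by rewrite !trmx_mul trmx_inv !mulmxA mulVmx // mul1mx.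
have trV g : g \in P -> (F g^-1%g)^T *m invmx V^T = invmx V^T *m perm_mx (c g).
  move=> Pg; rewrite -(tr_morph_perm cM Pg) -Vc ?groupV //.
  by rewrite !trmx_mul trmx_inv !mulmxA mulVmx // mul1mx.
exists r, f, N, (dual_lat B), s, c.
(* The base changes by [U] and [V] turn the actions on the two dual permutation lattices into
   literal permutation matrices. *)
exists (i^T *m invmx U^T), (U^T *m p^T *m invmx V^T).
exists (lsubmx E'^T), (usubmx E^T); split; first by split.
have Emap' g : g \in P ->
    E^T *m dual_lat B g = block_mx (A g) 0 0 (A' g^-1%g)^T *m E^T.
  move=> Pg; have := Emap _ (groupVr Pg) => /(congr1 trmx).
  by rewrite !trmx_mul tr_block_mx !trmx0 /dual_lat invgK trmxK => ->.
have EEt: E^T *m E'^T = 1%:M by rewrite -trmx_mul E'E trmx1.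
have EEt': E'^T *m E^T = 1%:M by rewrite -trmx_mul EE' trmx1.
split; [split|split].
- move=> g Pg; rewrite -mulmxA -trU // !mulmxA /dual_lat -!trmx_mul.
  by congr (_^T *m _); rewrite iE ?groupV.
- move=> g Pg; rewrite -mulmxA -trV // -!mulmxA [in LHS](mulmxA p^T).
  rewrite -trmx_mul -pE ?groupV // trmx_mul.
  rewrite -mulmxA !mulmxA; do 2!congr (_ *m _).
  by rewrite -[RHS](mulKVmx uUt) [invmx _ *m (_ *m _)]mulmxA -trU // mulmxKV.
- move=> w; exists (U^T *m u^T *m w).
  rewrite !mulmxA -(mulmxA i^T) mulVmx // mulmx1 -trmx_mul ui trmx1.
  by rewrite mul1mx.
- move=> v jv0; have: V^T *m z^T *m (invmx U^T *m (U^T *m p^T *m invmx V^T *m v)) = 0.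
    by rewrite jv0 !mulmx0.
  rewrite !mulmxA -(mulmxA (V^T *m z^T)) mulVmx // mulmx1 -(mulmxA V^T).
  by rewrite -trmx_mul pz trmx1 mulmx1 mulmxV // mul1mx.
- move=> v; split=> [qv0|[w ->]].
    exists (V^T *m (z^T *m (invmx U^T *m v))).
    rewrite !mulmxA -(mulmxA (U^T *m p^T)) mulVmx // mulmx1.
    rewrite -(mulmxA U^T) -trmx_mul.
    have ->: z *m p = 1%:M - i *m u by rewrite -Du opprB addrC subrK.
    rewrite linearB /= trmx1 mulmxBr mulmx1 !mulmxBl mulmxV // mul1mx.
    rewrite trmx_mul -!mulmxA (mulmxA i^T) qv0.
    by rewrite !mulmx0 subr0.
  rewrite !mulmxA -(mulmxA i^T) mulVmx // mulmx1 -trmx_mul pi0 trmx0.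
  by rewrite !mul0mx.
- move=> g Pg.
  have: dual_lat B g *m E'^T = E'^T *m block_mx (A g) 0 0 (A' g^-1%g)^T.
    rewrite -[LHS]mul1mx -EEt' -!mulmxA [E^T *m _]mulmxA Emap' //.
    by rewrite -mulmxA EEt mulmx1.
  move/(congr1 lsubmx); rewrite -{1 2}[E'^T]hsubmxK mul_mx_row mul_row_block.
  by rewrite !row_mxKl mulmx0 addr0 => ->.
- move=> g Pg; have := Emap' g Pg => /(congr1 usubmx).
  rewrite -{1 2}[E^T]vsubmxK mul_col_mx mul_block_col !col_mxKu.
  by rewrite mul0mx addr0.
- have := EEt; rewrite -{1}[E^T]vsubmxK -{1}[E'^T]hsubmxK mul_col_row.
  by rewrite scalar_mx_block => /eq_block_mx[].
Qed.

End Resolution.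

Lemma perm_resolution_sub (gT : finGroupType) (G P : {group gT}) n
    (A : gT -> 'M[int]_n) :
  P \subset G -> perm_resolution G A -> perm_resolution P A.
Proof.
move=> /subsetP sPG [r [f [N [B [s [c [q [j [sig [rho]]]]]]]]]].
case=> [[sM cM] [[qE jE surj_q inj_j ex] [sigE rhoE rs]]].
exists r, f, N, B, s, c, q, j, sig, rho; split; first by split=> x y /sPG + /sPG; auto.
by do 2?split=> //; move=> g /sPG; auto.
Qed.

(** * Orbits and stabilizers of a permutation representation *)

Section PermAction.

Variables (gT : finGroupType) (t : nat) (s : gT -> 'S_t).

Definition pstab (K : {set gT}) x : {set gT} := [set g in K | s g x == x].
Definition porb (K : {set gT}) x : {set 'I_t} := [set s g x | g in K].
(** A canonical orbit representative: [pick] sees only the orbit as a set, so all points of one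
    orbit get the same value. *)
Definition prep (K : {set gT}) x : 'I_t := odflt x [pick z in porb K x].

Lemma pstab_sub (K : {set gT}) x : pstab K x \subset K.
Proof. by apply/subsetP=> g; rewrite inE => /andP[]. Qed.

Lemma pstab_setI (K L : {set gT}) x :
  K \subset L -> pstab K x = K :&: pstab L x.
Proof.
move/subsetP=> sKL; apply/setP=> g; rewrite !inE.
by case Kg: (g \in K); rewrite ?(sKL _ Kg).
Qed.

Variables (K : {group gT}) (sM : {in K &, {morph s : x y / (x * y)%g}}).

Lemma morph_perm1 : s 1%g = 1%g.
Proof. by apply: (mulgI (s 1%g)); rewrite -sM // !mulg1. Qed.

Lemma morph_permV g : g \in K -> s g^-1%g = (s g)^-1%g.
Proof.
by move=> Kg; apply: (mulgI (s g)); rewrite -sM ?groupV // !mulgV morph_perm1.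
Qed.

(** Permutations compose from left to right, so this is a right action; correspondingly
    [perm_mx (s g)] sends the basis vector at [s g x] to the one at [x]. *)
Lemma perm_is_action : is_action K (fun x g => s g x).
Proof.
split=> [g|x g h Kg Kh]; first exact: perm_inj.
by rewrite sM // permM.
Qed.
Definition perm_action := Action perm_is_action.


Lemma pstab_astab1 x : pstab K x = 'C_K[x | perm_action]%g.
Proof.
apply/setP=> g; rewrite [LHS]inE [RHS]inE; have [Kg|//] := boolP (g \in K).
by rewrite /astab !inE sub1set inE Kg.
Qed.

Lemma pstab_group_set x : group_set (pstab K x).
Proof. by rewrite pstab_astab1 groupP. Qed.

Lemma porb_refl x : x \in porb K x.
Proof. exact: (@orbit_refl _ _ _ perm_action). Qed.

Lemma porb_eqP x z : reflect (porb K x = porb K z) (x \in porb K z).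
Proof. exact: (@orbit_in_eqP _ _ _ perm_action _ _ _ (subxx K)). Qed.

Lemma porb_sym x z : (x \in porb K z) = (z \in porb K x).
Proof. exact: (@orbit_in_sym _ _ _ perm_action _ (subxx K)). Qed.

Lemma mem_porb x g : g \in K -> s g x \in porb K x.
Proof. exact: imset_f. Qed.

Lemma porb_act x g : g \in K -> porb K (s g x) = porb K x.
Proof. by move=> Kg; apply/porb_eqP/mem_porb. Qed.

Lemma card_porb x : (#|porb K x| * #|pstab K x| = #|K|)%N.
Proof. by rewrite pstab_astab1; exact: (@card_orbit_in_stab _ _ _ perm_action _ _ (subxx K)). Qed.

Lemma eq_card_pstab x z : porb K x = porb K z -> #|pstab K x| = #|pstab K z|.
Proof.
move=> eq_xz; have := card_porb x; rewrite -(card_porb z) -eq_xz => /eqP.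
rewrite eqn_pmul2l => [/eqP//|].
by apply/card_gt0P; exists x; apply: porb_refl.
Qed.

(** The elements of [K] carrying [x] to a given point of its orbit form a right coset of the
    stabilizer. *)
Lemma sum_porb (F : 'I_t -> int) x :
  \sum_(g in K) F (s g x) = (\sum_(z in porb K x) F z) *+ #|pstab K x|.
Proof.
rewrite (partition_big (fun g => s g x) (mem (porb K x))) => [|g]; last first.
  exact: mem_porb.
rewrite -sumrMnl; apply: eq_bigr => z /imsetP[h Kh ->].
rewrite (eq_bigr (fun=> F (s h x))) => [|g /andP[_ /eqP->]//].
rewrite sumr_const pstab_astab1 -(card_rcoset 'C_K[x | perm_action]%g h).
rewrite -(amove_act perm_action x (subxx K) Kh); congr (_ *+ _).
by apply: eq_card => g; rewrite [RHS]inE.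
Qed.

Lemma prep_mem x : prep K x \in porb K x.
Proof. by rewrite /prep; case: pickP => //= _; apply: porb_refl. Qed.

Lemma prep_eq x z : (prep K x == prep K z) = (x \in porb K z).
Proof.
apply/eqP/porb_eqP=> [eq_xz | eq_xz].
  have /porb_eqP <- := prep_mem x; rewrite eq_xz.
  by apply/porb_eqP/prep_mem.
rewrite /prep eq_xz; case: pickP => //= /(_ z).
by rewrite porb_refl.
Qed.

Lemma prep_id x : prep K (prep K x) = prep K x.
Proof. by apply/eqP; rewrite prep_eq prep_mem. Qed.

Lemma prep_act x : exists2 k, k \in K & s k x = prep K x.
Proof. by have /imsetP[k Kk ->] := prep_mem x; exists k. Qed.

End PermAction.

(** * Subgroups of prescribed order in p-groups, and vanishing of H^1 *)

Lemma pgroup_intermediate (gT : finGroupType) (p : nat) (P S : {group gT}) m :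
    p.-group%g P -> S \subset P -> (#|S| %| m)%N -> (m %| #|P|)%N ->
  exists K : {group gT}, [/\ S \subset K, K \subset P & #|K| = m].
Proof.
have [n] := ubnP #|P|; elim: n P => // n IHn P lePn pP sSP dvSm dvmP.
have [eqmP|neqmP] := eqVneq #|P| m; first by exists P.
(* A maximal subgroup of [P] above [S] has index p, so [m] still divides its order when [m] differs
   from the order of [P]: descend to it. *)
case: (maximal_exists sSP) => [eqSP|[M maxM sSM]].
  by case/eqP: neqmP; apply/eqP; rewrite eqn_dvd -{1}eqSP dvSm.
have [sMP _] := andP (maxgroupp maxM).
have iMp := maximal.p_maximal_index pP maxM.
have DP: (#|P| = #|M| * p)%N by rewrite -iMp Lagrange.
have p_pr: prime p.
  have [P1|/(pgroup_pdiv pP)[]//] := eqVneq (P : {set gT}) 1%g.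
  by case/eqP: neqmP; move: dvmP; rewrite P1 cards1 dvdn1 => /eqP.
have [K [sSK sKM oK]]: exists K : {group gT}, [/\ S \subset K, K \subset M & #|K| = m].
  apply: IHn => //.
  - by rewrite ltnS in lePn; apply: leq_trans lePn; apply: proper_card; apply: maxgroupp maxM.
  - exact: pgroupS pP.
  have /p_natP[a Da] : p.-nat m by apply: pnat_dvd dvmP pP.
  have [b Db] := p_natP (pgroupS sMP pP : p.-nat #|M|).
  move: dvmP neqmP; rewrite DP Da Db -expnSr.
  rewrite dvdn_Pexp2l ?prime_gt1 // leq_eqVlt => /orP[/eqP->|].
    by rewrite eqxx.
  by rewrite dvdn_Pexp2l ?prime_gt1.
by exists K; split=> //; apply: subset_trans sMP.
Qed.

Lemma perm_H1_trivial (gT : finGroupType) (P : {group gT}) f (c : gT -> 'S_f)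
    (z : gT -> 'cV[int]_f) :
    {in P &, {morph c : x y / (x * y)%g}} ->
    {in P &, forall g h, z (g * h)%g = perm_mx (c g) *m z h + z g} ->
  exists phi, forall g, g \in P -> z g = perm_mx (c g) *m phi - phi.
Proof.
move=> cM zM; pose D := \sum_(h in P) z h.
(* [D / |P|] is a rational solution up to sign; its entries on an orbit agree
   modulo 1, so rounding down preserves the equation. *)
exists (- map_mx (fun a => (a %/ #|P|%:Z)%Z) D) => g Pg.
have DgE: perm_mx (c g) *m D = D - z g *+ #|P|.
  rewrite [in RHS]/D (reindex_inj (mulgI g)) /= -sumr_const mulmx_sumr.
  apply/eqP; rewrite eq_sym subr_eq -big_split; apply/eqP.
  under eq_bigl => h do rewrite groupMl //.
  by apply: eq_bigr => h Ph; rewrite zM.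
move: D DgE => D DgE; apply/colP=> x.
have Dx: D (c g x) 0 = D x 0 - z g x 0 *+ #|P|.
  by rewrite -mul_perm_mxE DgE mxE [X in _ + X]mxE mulmxnE.
rewrite mulmxN opprK mxE [X in X + _]mxE mul_perm_mxE !mxE Dx.
rewrite -mulr_natr -mulNr natz [X in - (X %/ _)%Z]addrC.
rewrite divzMDl ?opprD ?opprK; first by rewrite subrK.
by rewrite eqz_nat -lt0n cardG_gt0.
Qed.

(** * Transversals, augmentation ideals and the parity criterion *)

Lemma sum_mulg_transversal (gT : finGroupType) (K T P : {set gT})
    (V : zmodType) (F : gT -> V) :
    (K * T)%g = P -> (#|K| * #|T| = #|P|)%N ->
  \sum_(g in P) F g = \sum_(k in K) \sum_(x in T) F (k * x)%g.
Proof.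
move=> DP oP; rewrite pair_big /=.
have DP': P = [set (u.1 * u.2)%g | u in setX K T].
  rewrite -DP; apply/setP=> g; apply/mulsgP/imsetP=> [[k x Kk Tx ->]|].
    by exists (k, x); rewrite ?inE /= ?Kk.
  by case=> -[k x]; rewrite inE /= => /andP[Kk Tx] ->; exists k x.
rewrite {1}DP' big_imset /=; first by apply: eq_bigl => u; rewrite inE.
by apply/imset_injP; rewrite -DP' cardsX oP.
Qed.

(** Membership in I_K M, where I_K is the augmentation ideal of Z[K]: it is spanned by the k - 1, so
    one vector [w k] per element suffices. *)
Definition in_aug_ideal (gT : finGroupType) n (A : gT -> 'M[int]_n)
    (K : {set gT}) (u : 'cV[int]_n) : Prop :=
  exists w : gT -> 'cV_n, u = \sum_(k in K) (A k *m w k - w k).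

Lemma sum_group_translate (gT : finGroupType) (K : {group gT}) (V : zmodType)
    (F : gT -> V) k :
  k \in K -> \sum_(g in K) F (g * k)%g = \sum_(g in K) F g.
Proof.
move=> Kk; rewrite [RHS](reindex_inj (mulIg k)) /=.
by apply: eq_bigl => g; rewrite groupMr.
Qed.

(** The invariant form [lam] tests modulo 2 the membership of [y] in the sublattice of the overview.
    It is evaluated on a lift of [y], orbit by orbit: small stabilizers are handled by making the
    norm of the lift divisible by [m], large ones by the assumption on [lam]. *)
Lemma perm_resolution_even (gT : finGroupType) (P : {group gT}) n
    (A : gT -> 'M[int]_n) (m : nat) (y e : 'cV[int]_n) (lam : 'rV[int]_n) :
    2.-group%g P -> perm_resolution P A -> (m %| #|P|)%N ->
    (forall g, g \in P -> A g *m e = e) ->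
    \sum_(g in P) A g *m y = e *+ m ->
    (forall K : {group gT}, K \subset P -> #|K| = m -> exists T : {set gT},
       [/\ (K * T)%g = P, (#|K| * #|T| = #|P|)%N
         & in_aug_ideal A K (e - \sum_(x in T) A x *m y)]) ->
    (forall g, g \in P -> lam *m A g = lam) ->
    (forall (S : {group gT}) (u : 'cV_n), S \subset P -> (m <= #|S|)%N ->
       (forall g, g \in S -> A g *m u = u) -> (2 %| (lam *m u) 0%R 0%R)%Z) ->
  (2 %| (lam *m y) 0%R 0%R)%Z.
Proof.
move=> pP [r [f [N [B [s [c [q [j [sig [rho]]]]]]]]]] [[sM cM]].
case=> [[qE jE surj_q inj_j ex] [sigE rhoE rs]] dvmP eP Ny tre lamP lamS.
have inj_j' : injective (mulmx j : 'cV_f -> _).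
  move=> a b /= eq_ab; apply/eqP; rewrite -subr_eq0; apply/eqP/inj_j.
  by rewrite mulmxBr eq_ab subrr.
have [eR eRP qeR]: exists2 eR : 'cV_r,
    (forall g, g \in P -> perm_mx (s g) *m eR = eR) & q *m eR = sig *m e.
  (* The defect of invariance of an arbitrary lift [u] is a cocycle [z] with values in the lattice
     of [c]; writing it as a coboundary corrects [u]. *)
  have [u qu] := surj_q (sig *m e).
  have /fin_all_exists[z Dz]: forall g, exists zg : 'cV_f,
      g \in P -> perm_mx (s g) *m u - u = j *m zg.
    move=> g; have [Pg|_] := boolP (g \in P); last by exists 0.
    have /ex[zg ->] : q *m (perm_mx (s g) *m u - u) = 0.
      by rewrite mulmxBr mulmxA qE // -mulmxA qu mulmxA -sigE // -mulmxA eP // subrr.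
    by exists zg.
  have zM: {in P &, forall g h, z (g * h)%g = perm_mx (c g) *m z h + z g}.
    move=> g h Pg Ph; apply: inj_j'; rewrite /= mulmxDr mulmxA jE // -mulmxA.
    rewrite -!Dz ?groupM // sM // perm_mxM mulmxBr mulmxA.
    by rewrite addrA subrK.
  have [phi Dphi] := perm_H1_trivial cM zM.
  exists (u - j *m phi) => [g Pg|].
    rewrite mulmxBr mulmxA -jE // -mulmxA.
    have /(canRL (subrK _)) -> := esym (Dphi g Pg).
    have /(canRL (subrK _)) -> := Dz g Pg.
    by rewrite mulmxDr opprD addrACA subrr add0r.
  by rewrite mulmxBr qu (_ : q *m (j *m phi) = 0) ?subr0 //; apply/ex; exists phi.
have [r0 qr0] := surj_q (sig *m y).
pose Nr v : 'cV[int]_r := \sum_(g in P) perm_mx (s g) *m v.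
have q_act g v : g \in P -> q *m (perm_mx (s g) *m v) = B g *m (q *m v).
  by move=> Pg; rewrite mulmxA qE // -mulmxA.
have sig_act g v : g \in P -> sig *m (A g *m v) = B g *m (sig *m v).
  by move=> Pg; rewrite mulmxA sigE // -mulmxA.
have j_act g (v : 'cV_f) :
    g \in P -> j *m (perm_mx (c g) *m v) = perm_mx (s g) *m (j *m v).
  by move=> Pg; rewrite mulmxA jE // -mulmxA.
have [Phi DPhi]: exists Phi, eR *+ m - Nr r0 = j *m Phi.
  apply/ex; rewrite mulmxBr mulmx_sumr -scaler_nat -scalemxAr qeR.
  rewrite (eq_bigr (fun g => sig *m (A g *m y))) => [|g Pg].
    by rewrite -mulmx_sumr Ny -scaler_nat -scalemxAr subrr.
  by rewrite q_act // qr0 sig_act.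
(* Lifting the hypothesis on [K] shows that [eR] minus the sum of the translates of [r0] over [T] is
   some [j *m PhiK] modulo I_K R. The norm of [K] kills I_K R and turns the left side into
   [eR *+ m - Nr r0]. *)
have trPhi (K : {group gT}) : K \subset P -> #|K| = m -> exists PhiK : 'cV_f,
    Phi = \sum_(k in K) perm_mx (c k) *m PhiK.
  move=> sKP oK; have [T [DP oP [w Dw]]] := tre K sKP oK.
  have KP := subsetP sKP.
  have TP x : x \in T -> x \in P.
    by move=> Tx; rewrite -DP; apply/mulsgP; exists 1%g x; rewrite ?mul1g.
  have /fin_all_exists[W DW] k : exists Wk, q *m Wk = sig *m w k.
    exact: surj_q.
  have [PhiK DPhiK]: exists PhiK, eR - \sum_(x in T) perm_mx (s x) *m r0
      - \sum_(k in K) (perm_mx (s k) *m W k - W k) = j *m PhiK.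
    apply/ex; rewrite !mulmxBr qeR !mulmx_sumr.
    rewrite (eq_bigr (fun x => sig *m (A x *m y))) => [|x /TP Px]; last first.
      by rewrite q_act // qr0 sig_act.
    rewrite [X in _ - X](eq_bigr (fun k => sig *m (A k *m w k - w k))).
      by rewrite -!mulmx_sumr -!mulmxBr Dw subrr mulmx0.
    by move=> k /KP Pk; rewrite !mulmxBr q_act // DW sig_act.
  exists PhiK; apply: inj_j'; rewrite /= -DPhi mulmx_sumr.
  under eq_bigr => k /KP Pk do rewrite j_act // -DPhiK !mulmxBr.
  rewrite !sumrB; rewrite (eq_bigr (fun=> eR)) => [|k /KP/eRP//].
  rewrite sumr_const oK /Nr (sum_mulg_transversal _ DP oP).
  rewrite [X in _ = _ - X](_ : _ = 0) ?subr0; last first.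
    rewrite -sumrB.
    under eq_bigr => k _ do rewrite mulmx_sumr.
    rewrite exchange_big big1 // => l Kl /=.
    under eq_bigr => k Kk do rewrite mulmxBr mulmxA -perm_mxM -sM ?KP //.
    rewrite sumrB.
    by rewrite (sum_group_translate (fun k => perm_mx (s k) *m W l) Kl) subrr.
  congr (_ - _); apply: eq_bigr => k /KP Pk.
  rewrite mulmx_sumr; apply: eq_bigr => x /TP Px.
  by rewrite mulmxA -perm_mxM -sM.
have PhiP g x : g \in P -> Phi (c g x) 0 = Phi x 0.
  move=> Pg; rewrite -mul_perm_mxE (_ : _ *m _ = Phi) //; apply: inj_j'.
  rewrite /= j_act // -DPhi mulmxBr -scaler_nat -scalemxAr eRP //; congr (_ - _).
  rewrite mulmx_sumr; under eq_bigr => h Ph do rewrite mulmxA -perm_mxM -sM //.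
  rewrite [RHS](reindex_inj (mulgI g)) /=.
  by apply: eq_bigl => h; rewrite groupMl.
pose S x := Group (pstab_group_set cM x).
have SP x : S x \subset P := pstab_sub c P x.
have two_pow (H : {group gT}) : H \subset P -> (2.-nat #|H|)%N.
  by move=> sHP; apply: pgroupS pP.
have dv2 a b : (2.-nat a)%N -> (2.-nat b)%N -> (a <= b)%N -> (a %| b)%N.
  by move=> /p_natP[a' ->] /p_natP[b' ->]; rewrite leq_exp2l // => /dvdn_exp2l->.
have m2 : (2.-nat m)%N := pnat_dvd dvmP pP.
have dvPhi_gen (K : {group gT}) x : K \subset P -> #|K| = m ->
    (#|K :&: S x|%:Z %| Phi x 0%R)%Z.
  move=> sKP oK; have [PhiK ->] := trPhi K sKP oK; rewrite summxE.
  under eq_bigr => k _ do rewrite mul_perm_mxE.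
  have cMK : {in K &, {morph c : x y / (x * y)%g}}.
    by move=> ? ? /(subsetP sKP) + /(subsetP sKP); apply: cM.
  rewrite (sum_porb cMK (fun x => PhiK x 0)) -mulr_natr natz.
  by rewrite (pstab_setI _ _ sKP) dvdz_mull.
(* Taking [K] inside [S x] here, and containing [S x] in the next claim, gives [K :&: S x] the
   smaller of the orders [m] and [#|S x|]. *)
have dvPhi_ge x : (m <= #|S x|)%N -> (m%:Z %| Phi x 0%R)%Z.
  move=> le_mS; have dvmS := dv2 _ _ m2 (two_pow _ (SP x)) le_mS.
  have [|K [_ sKS oK]] := pgroup_intermediate (two_pow _ (SP x)) (sub1G _) _ dvmS.
    by rewrite cards1 dvd1n.
  have := dvPhi_gen K x (subset_trans sKS (SP x)) oK.
  by rewrite (setIidPl sKS) oK.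
have dvPhi_le x : (#|S x| <= m)%N -> (#|S x|%:Z %| Phi x 0%R)%Z.
  move=> le_Sm; have dvSm := dv2 _ _ (two_pow _ (SP x)) m2 le_Sm.
  have [K [sSK sKP oK]] := pgroup_intermediate pP (SP x) dvSm dvmP.
  by have := dvPhi_gen K x sKP oK; rewrite (setIidPr sSK).
(* Supported at one point per orbit with small stabilizer, where its norm then has coefficient
   exactly [Phi x 0]. On the other orbits [Phi] itself is divisible by [m]. *)
pose psi : 'cV[int]_f := \col_x
  if (prep c P x == x) && (#|S x| < m)%N then (Phi x 0%R %/ #|S x|%:Z)%Z else 0.
have [Psi DPsi]: exists Psi, Phi = \sum_(g in P) perm_mx (c g) *m psi + Psi *+ m.
  set Npsi := \sum_(g in P) _.
  exists (\col_x ((Phi - Npsi) x 0%R %/ m%:Z)%Z).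
  apply/colP=> x; rewrite mxE mulmxnE [X in _ = _ + X *+ m]mxE.
  rewrite -mulr_natr natz divzK.
    by rewrite -[Phi in LHS](subrK Npsi) mxE addrC.
  rewrite mxE [X in _ + X]mxE summxE.
  under eq_bigr => g _ do rewrite mul_perm_mxE.
  rewrite (sum_porb cM (fun x => psi x 0)).
  pose x0 := prep c P x; have orbx: x0 \in porb c P x by exact: prep_mem.
  have eqS : #|S x0| = #|S x| by apply: (eq_card_pstab cM); apply/(porb_eqP cM).
  have Phix0 : Phi x0 0 = Phi x 0.
    by rewrite /x0; have [k Pk <-] := prep_act cM x; rewrite PhiP.
  rewrite (bigD1 x0) //= big1 ?addr0 => [|z /andP[orbz neq_z]]; last first.
    rewrite mxE; case: eqP => //= Dz; case/eqP: neq_z.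
    by rewrite -Dz; apply/eqP; rewrite (prep_eq cM).
  rewrite mxE (prep_id cM) eqxx /= eqS Phix0.
  case: ltnP => [lt_Sm | le_mS]; last by rewrite mul0rn subr0 dvPhi_ge.
  by rewrite -mulr_natr natz divzK ?subrr ?dvdz0 // dvPhi_le // ltnW.
(* Still a lift of [y], but now with norm divisible by [m]. *)
pose r1 := r0 + j *m psi.
have Nr1 : Nr r1 = (eR - j *m Psi) *+ m.
  rewrite /Nr; under eq_bigr => g Pg do rewrite mulmxDr -j_act //.
  rewrite big_split /= -mulmx_sumr.
  have ->: \sum_(g in P) perm_mx (s g) *m r0 = eR *+ m - j *m Phi.
    by rewrite -DPhi opprB addrC subrK.
  rewrite DPsi mulmxDr -[Psi *+ m]scaler_nat -scalemxAr scaler_nat.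
  by rewrite addrAC opprD addrA [X in X - _]addrAC addrNK mulrnBl.
have qr1 : q *m r1 = sig *m y.
  by rewrite mulmxDr qr0 (_ : q *m (j *m psi) = 0) ?addr0 //; apply/ex; exists psi.
pose S' x := Group (pstab_group_set sM x).
have S'P x : S' x \subset P := pstab_sub s P x.
(* The norm at [x] is the orbit sum times [#|S' x|]; both this order and [m] are powers of 2, so [m]
   is a multiple of [#|S' x| * 2]. *)
have even_orb x : (#|S' x| < m)%N -> (2 %| \sum_(z in porb s P x) r1 z 0%R)%Z.
  move=> lt_Sm.
  have: (\sum_(z in porb s P x) r1 z 0) *+ #|S' x| = (eR - j *m Psi) x 0 *+ m.
    rewrite -mulmxnE -Nr1 summxE -(sum_porb sM (fun x => r1 x 0)).
    by apply: eq_bigr => g _; rewrite mul_perm_mxE.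
  rewrite -[LHS]mulr_natr -[RHS]mulr_natr !natz => eq_m.
  have /dvdnP[k Dk] : (#|S' x| * 2 %| m)%N.
    move: lt_Sm; have /p_natP[a Da] := two_pow _ (S'P x).
    by have /p_natP[b ->] := m2; rewrite Da -expnSr ltn_exp2l // => /dvdn_exp2l->.
  have S_neq0 : #|S' x|%:Z != 0 by rewrite eqz_nat -lt0n cardG_gt0.
  rewrite -(dvdz_mul2r S_neq0); apply/dvdzP.
  exists ((eR - j *m Psi) x 0 * k%:Z); rewrite eq_m Dk !PoszM.
  by rewrite -!mulrA; do 2!congr (_ * _); rewrite mulrC.
(* [lam] read on R: constant on orbits, with the value of [lam] on [y] at [r1], because [rho]
   retracts [sig]. *)
pose mu := lam *m rho *m q.
have muP g x : g \in P -> mu 0 (s g x) = mu 0 x.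
  move=> Pg; have: mu *m perm_mx (s g) = mu.
    by rewrite /mu -!mulmxA qE // [rho *m _]mulmxA rhoE // -mulmxA !mulmxA lamP.
  move/rowP/(_ (s g x)); rewrite mxE => <-.
  rewrite (bigD1 x) //= big1 ?addr0 => [|z neq_z]; first by rewrite !mxE eqxx mulr1.
  by rewrite !mxE (inj_eq perm_inj) (negPf neq_z) mulr0.
have ->: lam *m y = mu *m r1 by rewrite /mu -!mulmxA qr1 (mulmxA rho) rs mul1mx.
rewrite mxE (partition_big (prep s P) predT) //=; apply: rpred_sum => x _.
have [z0 z0x | no_z] := pickP (fun z => prep s P z == x); last first.
  by rewrite big_pred0 ?rpred0.
have fibx z : (prep s P z == x) = (z \in porb s P z0).
  by rewrite -(eqP z0x) (prep_eq sM).
have muz z : prep s P z == x -> mu 0 z * r1 z 0 = mu 0 z0 * r1 z 0.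
  by rewrite fibx => /imsetP[g Pg ->]; rewrite muP.
rewrite (eq_bigr _ muz) -mulr_sumr (eq_bigl _ _ fibx).
(* Either the orbit sum of [r1] is even, or the coefficient [mu 0 z0] is: it is the value of [lam]
   at a vector fixed by the large group [S' z0]. *)
have [lt_Sm | le_mS] := ltnP #|S' z0| m; first by rewrite dvdz_mull ?even_orb.
apply: dvdz_mulr.
pose d : 'cV[int]_r := delta_mx z0 0.
have ->: mu 0 z0 = (lam *m (rho *m (q *m d))) 0 0.
  by rewrite !mulmxA -/mu /d -colE [RHS]mxE.
apply: lamS (S'P z0) le_mS _ => g; rewrite inE => /andP[Pg /eqP sgz0].
rewrite mulmxA -rhoE // -mulmxA -q_act //; do 2!congr (_ *m _).
by apply/colP=> x'; rewrite mul_perm_mxE !mxE -{1}sgz0 (inj_eq perm_inj).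
Qed.

(** * Subgroups of index 2 and existence of transversals *)

Section IndexTwo.

Variables (gT : finGroupType) (P M : {group gT}).
Hypotheses (sMP : M \subset P) (iM : (#|M| * 2 = #|P|)%N).

Lemma index2_mul g h :
  g \in P -> g \notin M -> h \in P -> h \notin M -> (g * h)%g \in M.
Proof.
move=> Pg nMg Ph nMh.
have: (h^-1)%g \in (M :* g)%g.
  have ->: (M :* g)%g = P :\: M.
    apply/eqP; rewrite eqEcard cardsD (setIidPr sMP) card_rcoset -iM muln2 -addnn.
    rewrite addnK leqnn andbT; apply/subsetP=> _ /rcosetP[a Ma ->].
    by rewrite inE groupMl // nMg groupM // (subsetP sMP).
  by rewrite inE !groupV nMh.
case/rcosetP=> a Ma Dh; rewrite -(groupMl _ Ma) mulgA -Dh.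
by rewrite mulVg group1.
Qed.

Lemma index2_mulG (K : {group gT}) :
  K \subset P -> ~~ (K \subset M) -> (K * M)%g = P.
Proof.
move=> sKP /subsetPn[k Kk nMk]; apply/eqP; rewrite eqEsubset mul_subG //=.
apply/subsetP=> g Pg; have [Mg|nMg] := boolP (g \in M).
  by rewrite -[g]mul1g mem_mulg.
have Pk := subsetP sKP k Kk; rewrite -(mulKVg k g) mem_mulg //.
by rewrite index2_mul ?groupV.
Qed.

Lemma index2_setI (K : {group gT}) :
  K \subset P -> ~~ (K \subset M) -> (#|K :&: M| * 2 = #|K|)%N.
Proof.
move=> sKP nsKM; apply/eqP; rewrite -(eqn_pmul2r (cardG_gt0 M)).
by rewrite mul_cardG index2_mulG // -mulnA (mulnC 2) iM mulnC.
Qed.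

Lemma index2_memJ g h : g \in P -> (h ^ g \in M)%g = (h \in M).
Proof.
move=> Pg; have: (M <| P)%g.
  by apply: index2_normal; rewrite // -divgS // -iM mulKn ?cardG_gt0.
by case/andP=> _ /subsetP/(_ g Pg)/memJ_norm->.
Qed.

End IndexTwo.

Lemma mulg_transversal_exists (gT : finGroupType) (K P : {group gT}) :
  K \subset P -> exists T : {set gT},
    [/\ T \subset P, (K * T)%g = P & (#|K| * #|T| = #|P|)%N].
Proof.
move=> sKP; have partK := rcosets_partition sKP.
have trT := transversalP partK; set T := transversal _ _ in trT.
have sTP := transversal_sub trT.
exists T; split=> //; last by rewrite (card_transversal trT) Lagrange.
apply/eqP; rewrite eqEsubset mul_subG //=; apply/subsetP=> g Pg.
have Kg : (K :* g)%g \in rcosets K P by rewrite mem_rcosets mulSGid.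
have Tx := repr_mem_transversal trT 1%g Kg.
have := repr_mem_pblock trT 1%g Kg; rewrite rcoset_sym => /rcosetP[k Kk ->].
exact: mem_mulg.
Qed.

(** * Closure properties of augmentation ideals *)

Section AugIdeal.

Variables (gT : finGroupType) (n : nat) (A : gT -> 'M[int]_n) (K : {set gT}).

Lemma in_aug_ideal0 : in_aug_ideal A K 0.
Proof. by exists (fun=> 0); rewrite big1 // => k _; rewrite mulmx0 subr0. Qed.

Lemma in_aug_idealD u v :
  in_aug_ideal A K u -> in_aug_ideal A K v -> in_aug_ideal A K (u + v).
Proof.
move=> [w ->] [w' ->]; exists (fun k => w k + w' k); rewrite -big_split.
by apply: eq_bigr => k _; rewrite mulmxDr opprD addrACA.
Qed.

Lemma in_aug_idealZ a u : in_aug_ideal A K u -> in_aug_ideal A K (a *: u).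
Proof.
move=> [w ->]; exists (fun k => a *: w k); rewrite scaler_sumr.
by apply: eq_bigr => k _; rewrite scalerBr -scalemxAr.
Qed.

Lemma in_aug_ideal_gen k w : k \in K -> in_aug_ideal A K (A k *m w - w).
Proof.
move=> Kk; exists (fun h => if h == k then w else 0).
rewrite (bigD1 k) //= eqxx big1 ?addr0 // => h /andP[_ /negPf->].
by rewrite mulmx0 subr0.
Qed.

End AugIdeal.

Lemma in_aug_idealS (gT : finGroupType) n (A : gT -> 'M[int]_n)
    (K L : {set gT}) u :
  K \subset L -> in_aug_ideal A K u -> in_aug_ideal A L u.
Proof.
move=> sKL [w ->]; elim/big_ind: _ => [|a b|k Kk].
- exact: in_aug_ideal0.
- exact: in_aug_idealD.
by apply: in_aug_ideal_gen; apply: (subsetP sKL).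
Qed.

(** * The augmentation kernel Y of a permutation lattice Z[X] *)

Section AugmentationKernel.

Variables (gT : finGroupType) (P : {group gT}) (t : nat) (s : gT -> 'S_t).
Hypothesis sM : {in P &, {morph s : x y / (x * y)%g}}.
Variables (n : nat) (A : gT -> 'M[int]_n) (iota : 'M[int]_(t, n)).
Hypothesis iotaE : gmap P A (fun g => perm_mx (s g)) iota.
Hypothesis iota_im : forall v : 'cV_t,
  (const_mx 1 : 'rV_t) *m v = 0 <-> exists u, v = iota *m u.

Notation delta x := (delta_mx x 0 : 'cV[int]_t).

Lemma aug_kerP (v : 'cV[int]_t) :
  \sum_x v x 0 = 0 <-> exists u, v = iota *m u.
Proof.
apply: iff_trans (iota_im v); split=> [v0|/colP/(_ 0)].
  apply/colP=> i; rewrite (ord1 i) !mxE -[RHS]v0.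
  by apply: eq_bigr => x _; rewrite !mxE mul1r.
rewrite mxE [X in _ = X]mxE => v0; rewrite -[RHS]v0.
by apply: eq_bigr => x _; rewrite !mxE mul1r.
Qed.

Lemma sum_delta x : \sum_z delta x z 0 = 1.
Proof.
rewrite (bigD1 x) //= big1 => [|z /negPf neq_zx]; first by rewrite !mxE !eqxx addr0.
by rewrite !mxE neq_zx.
Qed.

Lemma delta_diff_lift x z : exists u, delta x - delta z = iota *m u.
Proof.
apply/aug_kerP; under eq_bigr => i _ do rewrite mxE [X in _ + X]mxE.
by rewrite sumrB !sum_delta subrr.
Qed.

Lemma act_delta g x : perm_mx (s g) *m delta (s g x) = delta x.
Proof. by apply/colP=> z; rewrite mul_perm_mxE !mxE (inj_eq perm_inj). Qed.

(** The image of I_K Y under [iota], so that membership can be checked by computing in Z[X]. *)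
Definition in_aug_image (K : {set gT}) (v : 'cV[int]_t) : Prop :=
  exists2 u, in_aug_ideal A K u & v = iota *m u.

Lemma in_aug_imageD K u v :
  in_aug_image K u -> in_aug_image K v -> in_aug_image K (u + v).
Proof.
move=> [a Ia ->] [b Ib ->]; exists (a + b); first exact: in_aug_idealD.
by rewrite mulmxDr.
Qed.

Lemma in_aug_imageZ K a v : in_aug_image K v -> in_aug_image K (a *: v).
Proof.
move=> [b Ib ->]; exists (a *: b); first exact: in_aug_idealZ.
by rewrite -scalemxAr.
Qed.

Lemma in_aug_image_delta (K : {set gT}) k x z : K \subset P -> k \in K ->
  in_aug_image K (perm_mx (s k) *m (delta x - delta z) - (delta x - delta z)).
Proof.
move=> sKP Kk; have [u ->] := delta_diff_lift x z.
exists (A k *m u - u); first exact: in_aug_ideal_gen.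
by rewrite mulmxBr !mulmxA iotaE ?(subsetP sKP).
Qed.

Definition porb_col (K : {set gT}) x : 'cV[int]_t :=
  \col_z (z \in porb s K x)%:R.

Section Subgroup.

Variable K : {group gT}.
Hypothesis sKP : K \subset P.

Let sMK : {in K &, {morph s : x y / (x * y)%g}}.
Proof. by move=> x y /(subsetP sKP) + /(subsetP sKP); apply: sM. Qed.

Lemma norm_delta x :
  \sum_(k in K) perm_mx (s k) *m delta x = porb_col K x *+ #|pstab s K x|.
Proof.
apply/colP=> z; rewrite summxE mulmxnE.
under eq_bigr => k _ do rewrite mul_perm_mxE.
rewrite (sum_porb sMK (fun z => delta x z 0)) mxE (porb_sym sMK).
have [orbx|orb'x] := boolP (x \in porb s K z).
  rewrite (eq_card_pstab sMK (elimT (porb_eqP sMK x z) orbx)); congr (_ *+ _).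
  rewrite (bigD1 x) //= big1 => [|w /andP[_ /negPf neq_w]].
    by rewrite mxE !eqxx addr0.
  by rewrite mxE neq_w.
rewrite big1 ?mul0rn // => w orbw; rewrite mxE.
by case: eqP orbw => // ->; rewrite (negPf orb'x).
Qed.

Lemma act_porb_col x k : k \in K -> perm_mx (s k) *m porb_col K x = porb_col K x.
Proof.
move=> Kk; apply/colP=> z; rewrite mul_perm_mxE !mxE.
by rewrite ![_ \in porb s K x](porb_sym sMK) (porb_act sMK).
Qed.

(** Given a fixed point [p], Y has the permuted basis of the x - p, and H^-1 of a permutation
    lattice vanishes. Explicitly, the orbit sums of [v] are zero, so [v] is a combination of
    differences x - k x, each obtained by applying some k - 1 to a difference with [p]. *)
Lemma norm0_in_aug_image p (v : 'cV[int]_t) :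
    (forall k, k \in K -> s k p = p) ->
    \sum_(k in K) perm_mx (s k) *m v = 0 -> in_aug_image K v.
Proof.
move=> fixp Nv0.
have ->: v = \sum_x v x 0 *: (delta x - delta (prep s K x)).
  under eq_bigr => x _ do rewrite scalerBr.
  rewrite sumrB [X in _ - X](_ : _ = 0) ?subr0; last first.
    apply/colP=> z; rewrite summxE mxE.
    under eq_bigr => x _ do rewrite !mxE eqxx andbT.
    rewrite (bigID (fun x => prep s K x == z)) /= [X in _ + X]big1 ?addr0; last first.
      by move=> x; rewrite eq_sym => /negPf->; rewrite mulr0.
    rewrite (eq_bigr (fun x => v x 0)) => [|x /eqP<-]; last by rewrite eqxx mulr1.
    have [z0 /eqP Dz|no_z] := pickP (fun x => prep s K x == z); last by rewrite big_pred0.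
    rewrite (eq_bigl (mem (porb s K z0))) => [|x]; last first.
      by rewrite -Dz (prep_eq sMK).
    have /eqP: (\sum_(x in porb s K z0) v x 0) *+ #|pstab s K z0| = 0.
      have /colP/(_ z0) := Nv0; rewrite summxE mxE => Nv0z.
      rewrite -[RHS]Nv0z -(sum_porb sMK (fun z => v z 0)).
      by apply: eq_bigr => k _; rewrite mul_perm_mxE.
    rewrite mulrn_eq0 => /orP[|/eqP//].
    by have := cardG_gt0 (Group (pstab_group_set sMK z0)); rewrite lt0n => /negPf /= ->.
  apply/colP=> z; rewrite summxE (bigD1 z) //= big1 ?addr0 => [|x neq_x].
    by rewrite !mxE !eqxx mulr1.
  by rewrite !mxE eq_sym (negPf neq_x) mulr0.
elim/big_ind: _ => [|a b|x _].
- by exists 0; [exact: in_aug_ideal0 | rewrite mulmx0].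
- exact: in_aug_imageD.
apply: in_aug_imageZ; have [k Kk <-] := prep_act sMK x.
have := in_aug_image_delta (s k x) p sKP Kk.
by rewrite mulmxBr act_delta -{1}(fixp k Kk) act_delta opprB addrA subrK.
Qed.

(** An invariant vector is constant on orbits, and every orbit of the 2-group in [D] has even
    length. *)
Lemma even_sum_nofix (D : {set 'I_t}) (v : 'cV[int]_t) :
    2.-group%g K ->
    (forall k x, k \in K -> x \in D -> s k x \in D) ->
    (forall x, x \in D -> pstab s K x != K) ->
    (forall k, k \in K -> perm_mx (s k) *m v = v) ->
  (2 %| \sum_(x in D) v x 0%R)%Z.
Proof.
move=> pK KD nofix vK; rewrite (partition_big (prep s K) predT) //=.
apply: rpred_sum => z _.
have [z0 /andP[Dz0 /eqP Dz]|no_z] := pickP (fun x => (x \in D) && (prep s K x == z)).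
  have orbD x : (x \in D) && (prep s K x == z) = (x \in porb s K z0).
    rewrite -Dz (prep_eq sMK) andbC; case orbx: (x \in porb _ _ _) => //=.
    by case/imsetP: orbx => k Kk ->; rewrite KD.
  rewrite (eq_bigl _ _ orbD) (eq_bigr (fun=> v z0 0)) => [|x /imsetP[k Kk ->]]; last first.
    by rewrite -mul_perm_mxE vK.
  rewrite sumr_const -[X in X \in _]mulr_natr natz; apply: dvdz_mull.
  have := card_porb sMK z0; have := nofix z0 Dz0; set o := #|_| => nK DK.
  have /p_natP[[|a] Do]: (2.-nat o)%N by apply: pnat_dvd pK; rewrite -DK dvdn_mulr.
    case/eqP: nK; apply/eqP; rewrite eqEcard pstab_sub.
    by rewrite -DK Do expn0 mul1n leqnn.
  by rewrite Do expnS dvdzE /= dvdn_mulr.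
by rewrite big_pred0 ?rpred0.
Qed.

End Subgroup.

End AugmentationKernel.

(** * The obstruction over a 2-group *)

Lemma notin_union_subgroups (gT : finGroupType) (S M1 M2 : {group gT}) :
    ~~ (S \subset M1) -> ~~ (S \subset M2) ->
  exists g, [/\ g \in S, g \notin M1 & g \notin M2].
Proof.
move=> /subsetPn[a Sa nM1a] /subsetPn[b Sb nM2b].
have [M2a|] := boolP (a \in M2); last by exists a.
have [M1b|] := boolP (b \in M1); last by exists b.
by exists (a * b)%g; rewrite groupM // groupMr // groupMl.
Qed.

(* [K] is the third subgroup of index 2 containing [M1 :&: M2]. *)
Lemma index2_pencil (gT : finGroupType) (P M1 M2 K : {group gT}) g :
    M1 \subset P -> (#|M1| * 2 = #|P|)%N -> M2 \subset P -> (#|M2| * 2 = #|P|)%N ->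
    K \subset P -> (#|K| * 2 = #|P|)%N -> ~~ (M2 \subset M1) ->
    ~~ (K \subset M1) -> K :&: M2 \subset M1 ->
    g \in P -> g \notin M1 -> g \notin M2 -> g \in K.
Proof.
move=> sM1 iM1 sM2 iM2 sK iK /subsetPn[h M2h nM1h] /subsetPn[k Kk nM1k] sKM Pg nM1g nM2g.
have Ph := subsetP sM2 h M2h; have Pk := subsetP sK k Kk.
have nKh: h \notin K.
  by apply: contra nM1h => Kh; apply: (subsetP sKM); rewrite inE Kh.
have nM2k: k \notin M2.
  by apply: contra nM1k => M2k; apply: (subsetP sKM); rewrite inE Kk.
rewrite -(mulgKV k g) groupMr //.
have z1: (g * k^-1)%g \in M1 by apply: (index2_mul sM1 iM1); rewrite ?groupV.
have z2: (g * k^-1)%g \in M2 by apply: (index2_mul sM2 iM2); rewrite ?groupV.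
apply: contraR nM1h => nKz; rewrite -(groupMl _ z1); apply: (subsetP sKM).
by rewrite inE (groupM z2 M2h) andbT (index2_mul sK iK) // (subsetP sM1).
Qed.

(** The parity criterion is applied to x2 - x1, on which the chosen form takes the value -1. The
    last hypothesis provides x2, and serves again when the orbit of x2 has only two points. *)
Lemma aug_kernel_no_resolution (gT : finGroupType) (P : {group gT}) t
    (s : gT -> 'S_t) n (A : gT -> 'M[int]_n) (iota : 'M[int]_(t, n)) x1 :
    2.-group%g P -> {in P &, {morph s : x y / (x * y)%g}} ->
    gmap P A (fun g => perm_mx (s g)) iota -> mx_injective iota ->
    (forall v : 'cV_t,
       (const_mx 1 : 'rV_t) *m v = 0 <-> exists u, v = iota *m u) ->
    (forall x, pstab s P x != P) -> (#|pstab s P x1| * 2 = #|P|)%N ->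
    (forall x2, (#|pstab s P x2| * 2 = #|P|)%N -> exists x,
       ~~ (pstab s P x \subset pstab s P x1)
         && ~~ (pstab s P x \subset pstab s P x2)) ->
  ~ perm_resolution P A.
Proof.
move=> pP sM iotaE iota_inj iota_im nofix iM1 nsub resA.
pose S x := Group (pstab_group_set sM x).
have SP x : S x \subset P := pstab_sub s P x.
(* Used with both points equal to [x1], so that the maximum defining [x2] is over a nonempty set. *)
have [x0 /andP[nx0 _]] := nsub x1 iM1.
pose M1 := S x1.
have [x2 nx2 max_x2]: exists2 x2, ~~ (S x2 \subset M1)
    & forall x, ~~ (S x \subset M1) -> (#|S x| <= #|S x2|)%N.
  by case: (@arg_maxnP _ x0 (fun x => ~~ (S x \subset M1)) (fun x => #|S x|) nx0)
    => x2 ? ?; exists x2.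
pose m := #|S x2|.
have oX2 : (#|porb s P x2| * m = #|P|)%N := card_porb sM x2.
have pow_X2 : (2.-nat #|porb s P x2|)%N by apply: pnat_dvd pP; rewrite -oX2 dvdn_mulr.
have [c Dc]: exists c, #|porb s P x2| = (c * 2)%N.
  have /p_natP[[|a] Da] := pow_X2; last by exists (2 ^ a)%N; rewrite Da expnSr.
  case/eqP: (nofix x2); apply/eqP; rewrite eqEcard pstab_sub.
  by rewrite -oX2 Da mul1n leqnn.
have mc : (m * c = #|M1|)%N.
  by apply/eqP; rewrite -(eqn_pmul2r (ltn0Sn 1)) iM1 -oX2 Dc [X in _ == X]mulnC mulnA.
have [g1 Pg1 nM1g1] : exists2 g, g \in P & g \notin M1.
  apply/subsetPn; apply: contra (nofix x1) => sPM.
  by rewrite eqEsubset SP.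
(* The other point of the two-point orbit of [x1]. *)
pose x1' := s g1 x1.
have fix1 g : g \in M1 -> s g x1 = x1 by rewrite inE => /andP[_ /eqP].
have move1 g : g \in P -> g \notin M1 -> s g x1 = x1'.
  move=> Pg nM1g; have: s (g * g1^-1)%g x1 = x1.
    by apply: fix1; apply: (index2_mul (SP x1) iM1); rewrite ?groupV.
  rewrite sM ?groupV // permM (morph_permV sM) // => eq1.
  by rewrite -(permKV (s g1) (s g x1)) eq1.
have move1' g : g \in P -> g \notin M1 -> s g x1' = x1.
  move=> Pg nM1g; rewrite /x1' -permM -sM //; apply: fix1.
  exact: (index2_mul (SP x1) iM1).
have neq1 : x1' != x1 by apply: contra nM1g1 => eq1; rewrite inE Pg1.
pose de x : 'cV[int]_t := delta_mx x 0.
have de1 g : g \in P -> g \notin M1 -> perm_mx (s g) *m de x1 = de x1'.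
  by move=> Pg nM1g; rewrite -{1}(move1' g Pg nM1g) act_delta.
have de1' g : g \in P -> g \notin M1 -> perm_mx (s g) *m de x1' = de x1.
  by move=> Pg nM1g; rewrite -{1}(move1 g Pg nM1g) act_delta.
have de1_fix g : g \in M1 -> perm_mx (s g) *m de x1 = de x1.
  by move=> M1g; rewrite -{1}(fix1 g M1g) act_delta.
have orb1 : porb_col s P x1 = de x1 + de x1'.
  apply/colP=> z; rewrite !mxE !andbT.
  have ->: (z \in porb s P x1) = (z == x1) || (z == x1').
    apply/imsetP/orP=> [[g Pg ->]|[/eqP->|/eqP->]]; last by exists g1.
      have [M1g|nM1g] := boolP (g \in M1); first by left; rewrite fix1.
      by right; rewrite move1.
    by exists 1%g; rewrite ?(morph_perm1 sM) ?perm1.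
  case: (eqVneq z x1) => [->|_]; last by rewrite add0r.
  by rewrite eq_sym (negPf neq1) addr0.
have [y Dy] := delta_diff_lift iota_im x2 x1.
pose ve := porb_col s P x2 - porb_col s P x1 *+ c.
have sum_orb x : \sum_z porb_col s P x z 0 = #|porb s P x|%:R.
  rewrite -sumr_const [RHS]big_mkcond /=; apply: eq_bigr => z _; rewrite mxE.
  by case: (z \in _).
have oX1 : #|porb s P x1| = 2%N.
  apply/eqP; rewrite -(eqn_pmul2r (cardG_gt0 M1)).
  by rewrite [X in _ == X]mulnC -[X in _ == (X * 2)%N]/#|pstab s P x1| iM1 (card_porb sM).
have [e De]: exists e, ve = iota *m e.
  apply/(aug_kerP iota_im).
  under eq_bigr => z _ do rewrite mxE [X in _ + X]mxE mulmxnE.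
  by rewrite sumrB sumrMnl !sum_orb Dc oX1 mulnC mulrnA subrr.
have eP g : g \in P -> A g *m e = e.
  move=> Pg; apply/eqP; rewrite -subr_eq0; apply/eqP/iota_inj.
  rewrite mulmxBr mulmxA iotaE // -mulmxA -De mulmxBr -scaler_nat -scalemxAr.
  by rewrite !(act_porb_col sM (subxx P)) // scaler_nat subrr.
have iota_sum (T : {set gT}) : T \subset P ->
    iota *m (\sum_(x in T) A x *m y) = \sum_(x in T) perm_mx (s x) *m (de x2 - de x1).
  move/subsetP=> sTP; rewrite mulmx_sumr; apply: eq_bigr => g /sTP Pg.
  by rewrite mulmxA iotaE // -mulmxA -Dy.
have Nde : \sum_(g in P) perm_mx (s g) *m (de x2 - de x1) = ve *+ m.
  under eq_bigr => g _ do rewrite mulmxBr.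
  rewrite sumrB !(norm_delta sM (subxx P)) mulrnBl; congr (_ - _).
  by rewrite -mulrnA mulnC mc.
have Ny : \sum_(g in P) A g *m y = e *+ m.
  apply/eqP; rewrite -subr_eq0; apply/eqP/iota_inj.
  by rewrite mulmxBr iota_sum // Nde -[e *+ m]scaler_nat -scalemxAr scaler_nat -De subrr.
have dvmP : (m %| #|P|)%N by rewrite -oX2 dvdn_mull.
have in_aug (K T : {set gT}) : T \subset P ->
    in_aug_image A iota K (ve - \sum_(x in T) perm_mx (s x) *m (de x2 - de x1)) ->
    in_aug_ideal A K (e - \sum_(x in T) A x *m y).
  move=> sTP [u Iu]; rewrite De -iota_sum // -mulmxBr => eq_u.
  suff ->: e - \sum_(x in T) A x *m y = u by [].
  apply/eqP; rewrite -subr_eq0; apply/eqP/iota_inj.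
  by rewrite mulmxBr eq_u subrr.
(* [M1] is transitive on the orbit of [x2]: an element outside [M1] can be corrected by one of
   [S x2] outside [M1]. *)
have orbM1 : porb s M1 x2 = porb s P x2.
  apply/eqP; rewrite eqEsubset; apply/andP; split; first exact: imsetS (SP x1).
  apply/subsetP=> _ /imsetP[g Pg ->].
  have [M1g|nM1g] := boolP (g \in M1); first exact: imset_f.
  have /subsetPn[h] := nx2; rewrite inE => /andP[Ph /eqP fixh] nM1h.
  by rewrite -{1}fixh -permM -sM //; apply/imset_f/(index2_mul (SP x1) iM1).
have sMM1 : {in M1 &, {morph s : x y / (x * y)%g}}.
  by move=> a b /(subsetP (SP x1)) + /(subsetP (SP x1)); apply: sM.
have oM1x2 : (#|pstab s M1 x2| * 2 = m)%N.
  apply/eqP; rewrite -(eqn_pmul2l (_ : 0 < #|porb s P x2|)%N).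
    by rewrite oX2 mulnA -{1}orbM1 (card_porb sMM1) iM1.
  by apply/card_gt0P; exists x2; apply: porb_refl.
have tre (K : {group gT}) : K \subset P -> #|K| = m -> exists T : {set gT},
    [/\ (K * T)%g = P, (#|K| * #|T| = #|P|)%N
      & in_aug_ideal A K (e - \sum_(x in T) A x *m y)].
  move=> sKP oK; have KP := subsetP sKP.
  (* If [K] fixes [x1], it suffices that the norm over [K] vanishes: it multiplies [ve] by [m], and
     turns the sum over [T] into the norm over [P], which is also [ve *+ m]. *)
  have [sKM | nsKM] := boolP (K \subset M1).
    have [T [sTP DP oP]] := mulg_transversal_exists sKP; exists T; split=> //.
    apply: (in_aug _ _ sTP); apply: (norm0_in_aug_image sM iotaE iota_im sKP (p := x1)).
      by move=> k /(subsetP sKM)/fix1.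
    under eq_bigr => k Kk.
      rewrite mulmxBr mulmx_sumr [X in X - _](_ : _ = ve); first over.
      rewrite mulmxBr -scaler_nat -scalemxAr.
      by rewrite !(act_porb_col sM (subxx P)) ?KP // scaler_nat.
    rewrite sumrB sumr_const oK -Nde (sum_mulg_transversal _ DP oP).
    apply/eqP; rewrite subr_eq0; apply/eqP; apply: eq_bigr => k Kk.
    apply: eq_bigr => x /(subsetP sTP) Px.
    by rewrite (sM k x (KP k Kk) Px) perm_mxM mulmxA.
  (* [M1] is transitive on the orbit of [x2]: with a transversal of [K1] in
     [M1], the part supported on this orbit has norm 0 over [K1], and [K1]
     fixes [x1]. *)
  pose K1 := (K :&: M1)%G.
  have oK1 : (#|K1| * 2 = #|K|)%N := index2_setI (SP x1) iM1 sKP nsKM.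
  have sK1M : K1 \subset M1 := subsetIr K M1.
  have sK1P : K1 \subset P := subset_trans sK1M (SP x1).
  have [T [sTM DM oM]] := mulg_transversal_exists sK1M.
  have TM := subsetP sTM.
  have oT : #|T| = (c * 2)%N.
    have K1_gt0 := cardG_gt0 K1.
    apply/eqP; rewrite -(eqn_pmul2l K1_gt0) oM -mc -oK -oK1.
    by rewrite -mulnA (mulnC 2).
  exists T; split.
  - have {1}->: (K : {set gT}) = (K * K1)%g by rewrite mulGSid ?subsetIl.
    by rewrite -mulgA DM (index2_mulG (SP x1) iM1).
  - by rewrite oT oK -Dc mulnC oX2.
  apply: in_aug; first exact: subset_trans (SP x1).
  under eq_bigr => x Tx do rewrite mulmxBr de1_fix ?TM //.
  rewrite sumrB sumr_const oT.
  (* As [T] lies in [M1], its sum contains [x1] exactly 2c times; against c (x1 + x1') this leaves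
     -c (x1' - x1). *)
  have ->: ve - (\sum_(x in T) perm_mx (s x) *m de x2 - de x1 *+ (c * 2))
     = (porb_col s P x2 - \sum_(x in T) perm_mx (s x) *m de x2)
       + (- c%:R) *: (de x1' - de x1).
    rewrite /ve orb1 scaleNr scaler_nat mulrnA mulr2n !mulrnDl mulNrn.
    rewrite !opprD !opprK addrACA; congr (_ + _).
    by rewrite [in LHS](addrC (- _)) addrA addrNK.
  apply: in_aug_imageD.
    have [u Iu ->]: in_aug_image A iota K1
        (porb_col s P x2 - \sum_(x in T) perm_mx (s x) *m de x2).
      apply: (norm0_in_aug_image sM iotaE iota_im sK1P (p := x1)).
        by move=> k /(subsetP sK1M)/fix1.
      under eq_bigr => k Kk.
        rewrite mulmxBr mulmx_sumr (act_porb_col sM (subxx P)) ?(subsetP sK1P) //.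
        over.
      rewrite sumrB sumr_const.
      have: \sum_(g in M1) perm_mx (s g) *m de x2 = porb_col s P x2 *+ #|K1|.
        rewrite (norm_delta sM (SP x1)) /porb_col orbM1; congr (_ *+ _).
        by apply/eqP; rewrite -(eqn_pmul2r (ltn0Sn 1)) oM1x2 oK1 oK.
      move=> <-; rewrite (sum_mulg_transversal _ DM oM) -sumrB big1 // => k K1k.
      rewrite -sumrB big1 // => x /TM/(subsetP (SP x1)) Px.
      by rewrite (sM k x (subsetP sK1P k K1k) Px) perm_mxM mulmxA subrr.
    by exists u => //; apply: in_aug_idealS Iu; apply: subsetIl.
  have [k0 Kk0 nM1k0] := subsetPn nsKM.
  (* Two ways to get c (x1' - x1): (k0 - 1)(x1 - x1') = 2 (x1' - x1) if [c] is even, and (k - 1)(x1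
     - p) = x1' - x1 if [k] outside [M1] fixes [p]. *)
  have even_c_or_fix: ~~ odd c \/ exists2 k, k \in K & k \notin M1 /\ exists p, s k p = p.
    have [odd_c|] := boolP (odd c); [right | by left].
    have c1 : c = 1%N.
      have /p_natP[[|[|a]] Da] := pow_X2; move: Da; rewrite Dc.
      - by case: (c) odd_c => // c' _ /(congr1 odd); rewrite muln2 odd_double.
      - by rewrite expn1 => /eqP; rewrite -[X in _ == X]mul1n eqn_pmul2r // => /eqP.
      rewrite expnSr => /eqP; rewrite eqn_pmul2r // expnSr => /eqP Dc'.
      by move: odd_c; rewrite Dc' muln2 odd_double.
    have im : (m * 2 = #|P|)%N by rewrite -oX2 Dc c1 mulnC.
    (* Now [M1], [S x2] and [K] all have index 2. Either [K :&: S x2] leaves [M1], and [x2] is the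
       fixed point, or [K] contains every element of [S x] outside both [M1] and [S x2]. *)
    have [x /andP[nx1 nx2']] := nsub x2 im.
    have [sKS|/subsetPn[k]] := boolP (K :&: S x2 \subset M1); last first.
      rewrite inE => /andP[Kk]; rewrite inE => /andP[_ /eqP fixk] nM1k.
      by exists k => //; split=> //; exists x2.
    have [g [Sg nM1g nM2g]] := @notin_union_subgroups _ (S x) M1 (S x2) nx1 nx2'.
    have Pg := subsetP (SP x) g Sg; exists g.
      by apply: (@index2_pencil _ P M1 (S x2) K g) => //; [apply: SP | rewrite oK].
    by split=> //; exists x; move: Sg; rewrite inE => /andP[_ /eqP].
  case: even_c_or_fix => [even_c | [k Kk [nM1k [p fixp]]]].
    have ->: c%:R = c./2%:R * 2%:R :> int.
      by rewrite -natrM muln2 even_halfK.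
    rewrite -mulNr -scalerA; apply: in_aug_imageZ.
    have := in_aug_image_delta iotaE iota_im x1 x1' sKP Kk0.
    rewrite mulmxBr -!/(de _) de1 ?de1' ?KP // opprB.
    by rewrite -mulr2n -scaler_nat.
  apply: in_aug_imageZ.
  have := in_aug_image_delta iotaE iota_im x1 p sKP Kk.
  rewrite mulmxBr -!/(de _) de1 ?KP //.
  by rewrite -[in X in X -> _]fixp -/(de _) act_delta opprB addrA fixp subrK.
(* [lam] sums the coefficients over [Z], which is stable under [P] because [M1] is normal. *)
pose Z := [set x | S x \subset M1].
pose lam : 'rV[int]_n := (\row_x (x \in Z)%:R) *m iota.
have lamE u : (lam *m u) 0 0 = \sum_(x in Z) (iota *m u) x 0.
  rewrite -mulmxA mxE [RHS]big_mkcond; apply: eq_bigr => x _; rewrite mxE.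
  by case: (x \in Z); rewrite ?mul1r ?mul0r.
have ZP g x : g \in P -> (s g x \in Z) = (x \in Z).
  have sub z h : h \in P -> z \in Z -> s h z \in Z.
    move=> Ph; rewrite !inE => /subsetP sSM; apply/subsetP=> k.
    rewrite inE => /andP[Pk /eqP fixk].
    rewrite -(index2_memJ (SP x1) iM1 k (groupVr Ph)); apply: sSM.
    rewrite inE conjgE invgK !groupM ?groupV //=.
    by rewrite !sM ?groupM ?groupV // !permM fixk (morph_permV sM) // permK.
  move=> Pg; apply/idP/idP; last exact: sub.
  by move/(sub _ g^-1%g (groupVr Pg)); rewrite (morph_permV sM) // permK.
have lamP g : g \in P -> lam *m A g = lam.
  move=> Pg; rewrite -mulmxA iotaE // mulmxA; congr (_ *m _).
  apply/rowP=> z; rewrite mxE (bigD1 ((s g)^-1%g z)) //= big1 ?addr0.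
    rewrite !mxE permKV eqxx mulr1 -(ZP g) ?permKV //.
  move=> x neq_x; rewrite !mxE; case: eqP => [Dz|]; last by rewrite mulr0.
  by case/eqP: neq_x; rewrite -Dz permK.
have: (2 %| (lam *m y) 0%R 0%R)%Z.
  apply: (perm_resolution_even pP resA dvmP eP Ny tre lamP) => H u sHP le_mH uH.
  have HP := subsetP sHP.
  have invH k : k \in H -> perm_mx (s k) *m (iota *m u) = iota *m u.
    by move=> Hk; rewrite mulmxA -iotaE ?HP // -mulmxA uH.
  have pH : 2.-group%g H := pgroupS sHP pP.
  have fixS x : pstab s H x = H -> H \subset S x.
    move=> DH; apply/subsetP=> h; rewrite -[in X in X -> _]DH !inE.
    by case/andP=> /HP->.
  rewrite lamE.
  (* If [H] fixes a point of [Z], then it lies in [M1] and fixes no point outside [Z]: there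
     [S x :&: M1] has order at most m/2 by maximality of [x2]. As the total sum is 0, the sum over
     the complement decides. *)
  have [/existsP[z /andP[Zz /eqP Hz]]|nofixZ] :=
      boolP [exists z, (z \in Z) && (pstab s H z == H)].
    have sHM : H \subset M1.
      by apply: subset_trans (fixS z Hz) _; rewrite inE in Zz.
    have even_ZC : (2 %| \sum_(x in ~: Z) (iota *m u) x 0%R)%Z.
      apply: (even_sum_nofix sM sHP pH) => // [k x Hk|x].
        by rewrite !in_setC ZP ?HP.
      rewrite !inE => nZx; apply/eqP=> /fixS sHS.
      have := index2_setI (SP x1) iM1 (SP x) nZx.
      have := leq_trans le_mH (subset_leq_card (_ : H \subset S x :&: M1)).
      rewrite subsetI sHS sHM => /(_ isT) le_m oSM.
      have := leq_trans (max_x2 x nZx) le_m; rewrite -oSM.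
      by rewrite muln2 -addnn -[X in (_ <= X)%N]addn0 leq_add2l leqNgt cardG_gt0.
    have := iffRL (aug_kerP iota_im _) (ex_intro _ u (erefl _)).
    rewrite (bigID (mem Z)) /= => /eqP; rewrite addr_eq0 => /eqP->.
    rewrite rpredN (eq_bigl (mem (~: Z))) // => x.
    by rewrite /= in_setC.
  apply: (even_sum_nofix sM sHP pH) => // [k x Hk|x Zx].
    by rewrite ZP ?HP.
  by move: nofixZ; rewrite negb_exists => /forallP/(_ x); rewrite Zx.
rewrite lamE -Dy.
under eq_bigr => x _ do rewrite mxE [X in _ + X]mxE.
rewrite sumrB [X in X - _]big1 => [|x Zx]; last first.
  rewrite mxE andbT; case: eqP Zx => // ->; rewrite inE.
  by rewrite (negPf nx2).
have Z1 : x1 \in Z by rewrite inE.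
rewrite (bigD1 x1) //= big1 => [|x /andP[_ /negPf neq_x]]; last by rewrite mxE neq_x.
by rewrite mxE !eqxx.
Qed.

(** * The coset representation as permutations *)

Section CosetPermutation.

Variables (gT : finGroupType) (G : {group gT}) (HH : {set {group gT}}).

Lemma coset_basisP u :
  reflect (exists H x, [/\ H \in HH, x \in G & u = (H, lcoset H x)])
          (u \in coset_basis G HH).
Proof.
apply: (iffP imset2P) => [[H x HHH Gx ->]|[H [x [HHH Gx ->]]]].
  by exists H, x.
by exists H x.
Qed.

(** [s g] is translation by the inverse of [g], which matches the right-action convention for
    [perm_mx]. *)
Lemma coset_rep_perm : exists s : gT -> 'S_#|coset_basis G HH|,
  [/\ {in G &, {morph s : x y / (x * y)%g}},
      forall g, g \in G -> coset_rep G HH g = perm_mx (s g)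
    & forall g i, g \in G ->
        enum_val (s g i) = ((enum_val i).1, lcoset (enum_val i).2 g^-1%g)].
Proof.
have lcosetK' g : cancel (lcoset^~ g) (fun B : {set gT} => lcoset B g^-1%g).
  by move=> B /=; rewrite !lcosetE lcosetK.
have lcosetM' B g h : lcoset B (g * h)%g = lcoset (lcoset B h) g :> {set gT}.
  by rewrite !lcosetE lcosetM.
have /fin_all_exists[s Ds] : forall g, exists sg : 'S_#|coset_basis G HH|, g \in G ->
    forall i, enum_val (sg i) = ((enum_val i).1, lcoset (enum_val i).2 g^-1%g).
  move=> g; have [Gg|_] := boolP (g \in G); last by exists 1%g.
  have basis (i : 'I_#|coset_basis G HH|) :
      ((enum_val i).1, lcoset (enum_val i).2 g^-1%g) \in coset_basis G HH.
    have /coset_basisP[H [x [HHH Gx ->]]] := enum_valP i; rewrite /= -lcosetM'.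
    by apply/coset_basisP; exists H, (g^-1 * x)%g; rewrite groupM ?groupV.
  pose f (i : 'I_#|coset_basis G HH|) :=
    enum_rank_in (enum_valP i) ((enum_val i).1, lcoset (enum_val i).2 g^-1%g).
  have fE i : enum_val (f i) = ((enum_val i).1, lcoset (enum_val i).2 g^-1%g).
    by rewrite enum_rankK_in.
  have inj_f : injective f.
    move=> i j /(congr1 enum_val); rewrite !fE => -[eq1 eq2].
    apply: enum_val_inj; rewrite [LHS]surjective_pairing [RHS]surjective_pairing.
    by rewrite eq1 (can_inj (lcosetK' _) eq2).
  by exists (perm inj_f) => _ i; rewrite permE.
exists s; split=> [x y Gx Gy|g Gg|g i Gg]; last exact: Ds.
  apply/permP=> i; apply: enum_val_inj; rewrite permM !Ds ?groupM //=.
  by rewrite invMg lcosetM'.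
apply/matrixP=> i j; rewrite !mxE -(inj_eq enum_val_inj) Ds //.
rewrite [X in _ = (_ == X)%:R]surjective_pairing xpair_eqE.
rewrite -[X in _ = (_ && (_ == X))%:R](lcosetK' g) (inj_eq (can_inj (lcosetK' _))).
by rewrite natz.
Qed.

End CosetPermutation.

(** * Intersections of a Sylow 2-subgroup with conjugates of subgroups *)

Section SylowStabilizers.

Variables (gT : finGroupType) (G P : {group gT}).
Hypothesis sylP : 2.-Sylow(G)%g P.

Let sPG : P \subset G := pHall_sub sylP.
Let pP : 2.-group%g P := pHall_pgroup sylP.

Lemma card_Sylow_conjI (H : {group gT}) a : (#|P :&: (H :^ a)%g| <= #|H|`_2)%N.
Proof.
apply: dvdn_leq (part_gt0 _ _) _; set S := P :&: _.
have pS : (2.-nat #|S|)%N by apply: pgroupS pP; apply: subsetIl.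
rewrite -(part_pnat_id pS) partn_dvd ?cardG_gt0 //.
by rewrite -(cardJg H a) cardSg // subsetIr.
Qed.

Lemma Sylow_conjI_exists (H : {group gT}) : H \subset G ->
  exists2 a, a \in G & #|P :&: (H :^ a)%g| = (#|H|`_2)%N.
Proof.
move=> sHG; have [Q sylQ] := Sylow_exists 2 H.
have [sQH pQ oQ] := and3P sylQ.
have [x Gx sQP] := Sylow_subJ sylP (subset_trans sQH sHG) pQ.
exists (x^-1)%g; rewrite ?groupV //; apply/eqP.
rewrite eqn_leq card_Sylow_conjI -(card_Hall sylQ) -(cardJg Q x^-1) subset_leq_card //.
by rewrite subsetI conjSg sQH andbT sub_conjgV.
Qed.

Lemma card_Sylow_part (H : {group gT}) : H \subset G ->
  #|P| = (#|H|`_2 * #|G : H|%g`_2)%N.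
Proof.
by move=> sHG; rewrite (card_Hall sylP) -(Lagrange sHG) partnM ?cardG_gt0 ?indexg_gt0.
Qed.

(** With N the core of [H], [P] is the product of [N :&: P] and [P :&: H' :^ b]: compare orders,
    using that N and the conjugate of [H'] still have product [G] and that the two factors are Sylow
    in them. The first factor lies in every conjugate of [H]. *)
Lemma Sylow_core_mul (H H' M : {group gT}) a b :
    H \subset G -> H' \subset G -> (coreG G H * H')%g = G :> {set gT} ->
    a \in G -> b \in G -> #|P :&: (H' :^ b)%g| = (#|H'|`_2)%N ->
    P :&: (H :^ a)%g \subset M -> P :&: (H' :^ b)%g \subset M -> P \subset M.
Proof.
move=> sHG sH'G DG Ga Gb oT sSM sTM.
pose N := [group of gcore H G]; pose H2 := (H' :^ b)%G; pose T := (P :&: H2)%G.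
have nNG : (N <| G)%g := gcore_normal sHG.
have DG2 : (N * H2)%g = G :> {set gT}.
  have /normP nNb : b \in ('N(N))%g by apply: (subsetP (normal_norm nNG)).
  by rewrite -[RHS](conjGid Gb) -DG conjsMg -[coreG G H]/(gval N) nNb.
have sylPN : (2.-Sylow(N) (N :&: P))%g := Sylow_setI_normal nNG sylP.
have sNH : N \subset (H :^ a)%g by apply: bigcap_inf.
suff /eqP <- : ((N :&: P) * T)%g == P.
  by rewrite mul_subG // (subset_trans _ sSM) // setIC setIS.
rewrite eqEcard mul_subG ?subsetIl ?subsetIr //=.
rewrite -(leq_pmul2r (cardG_gt0 (N :&: T))).
have: (#|N :&: T| <= #|N :&: H2|`_2)%N.
  apply: dvdn_leq (part_gt0 _ _) _.
  have pNT : (2.-nat #|N :&: T|)%N.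
    by apply: pgroupS pP; rewrite /= setICA subsetIl.
  by rewrite -(part_pnat_id pNT) partn_dvd ?cardG_gt0 // cardSg //= setIS ?subsetIr.
move=> le_NT; apply: leq_trans (_ : #|P| * #|N :&: H2|`_2 <= _)%N.
  by rewrite leq_mul2l le_NT orbT.
rewrite [X in (_ <= _ * X)%N](_ : _ = #|(N :&: P) :&: T|); last first.
  by rewrite -setIA /= (setIA P) setIid.
rewrite -mul_cardG (card_Hall sylPN) (card_Hall sylP) -partnM ?cardG_gt0 //.
rewrite -[in X in (X <= _)%N]DG2 -mul_cardG partnM ?cardG_gt0 //.
by rewrite /= oT cardJg leqnn.
Qed.

End SylowStabilizers.

(** * Reduction to a Sylow 2-subgroup and use of speciality *)

Theorem theorem5p5 (gT : finGroupType) (G : {group gT}) (HH : {set {group gT}}) :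
  (forall H, H \in HH -> H \subset G) ->
  reduced HH -> (2 <= #|HH|)%N -> dG G HH = 2%N ->
  ((#|HH| = 2%N /\ special G HH /\ exists2 H, H \in HH & (4 %| #|G : H|%g)%N)
   \/ ((3 <= #|HH|)%N /\
       exists2 HH0 : {set {group gT}}, HH0 \subset HH &
         (3 <= #|HH0|)%N /\ special G HH0)) ->
  (* (n, A) is the G-lattice I_{G/HH}: via iota it is the kernel of the sum of
     augmentation maps (+)_{H in HH} Z[G/H] -> Z *)
  forall (n : nat) (A : gT -> 'M[int]_n)
         (iota : 'M[int]_(#|coset_basis G HH|, n)),
    is_glat G A ->
    gmap G A (coset_rep G HH) iota ->
    mx_injective iota ->
    (forall v : 'cV[int]_#|coset_basis G HH|,
        aug_map G HH *m v = 0 <-> exists u, v = iota *m u) ->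
  (* then J_{G/HH} = I_{G/HH}° is not quasi-invertible *)
  ~ is_quasi_invertible G (dual_lat A).
Proof.
move=> sHG _ _ dG2 cases n A iota _ iotaE iota_inj iota_im qinv.
have [P sylP] := Sylow_exists 2 G.
have [sPG pP _] := and3P sylP; have PG := subsetP sPG.
have resP := perm_resolution_sub sPG (quasi_invertible_resolution qinv).
have [s [sM sE s_val]] := coset_rep_perm G HH.
(* The point is the coset of [a^-1], whose stabilizer in [G] is [H :^ a]. *)
have stab_pt (H : {group gT}) a : H \in HH -> a \in G ->
    exists x, pstab s P x = P :&: (H :^ a)%g.
  move=> HHH Ga; have basis_u: (H, lcoset H a^-1%g) \in coset_basis G HH.
    by apply/coset_basisP; exists H, (a^-1)%g; rewrite groupV.
  pose x := enum_rank_in basis_u (H, lcoset H a^-1%g); exists x.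
  apply/setP=> g; rewrite !inE; have [/PG Gg|//] := boolP (g \in P).
  rewrite -(inj_eq enum_val_inj) s_val // enum_rankK_in //= xpair_eqE eqxx /=.
  rewrite !lcosetE -lcosetM (sameP eqP lcoset_eqP) mem_lcoset invgK.
  by rewrite mem_conjg -[RHS]groupV conjgE !invMg !invgK !mulgA.
have pt_stab x : exists H a, [/\ H \in HH, a \in G
    & pstab s P x = P :&: (H :^ a)%g].
  have /coset_basisP[H [a [HHH Ga Dx]]] := enum_valP x.
  exists H, (a^-1)%g; split; rewrite ?groupV //; apply/setP=> g; rewrite !inE.
  have [/PG Gg|//] := boolP (g \in P).
  rewrite -(inj_eq enum_val_inj) s_val // Dx xpair_eqE eqxx /=.
  rewrite !lcosetE -lcosetM (sameP eqP lcoset_eqP) mem_lcoset.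
  by rewrite mem_conjgV -[RHS]groupV conjgE !invMg invgK !mulgA.
have dvd2 H : H \in HH -> (2 %| #|G : H|%g)%N.
  by move: H; apply/dvdn_biggcdP; rewrite -[X in (_ %| X)%N]/(dG G HH) dG2.
have part_ge k (H : {group gT}) : H \in HH -> (2 ^ k %| #|G : H|%g)%N ->
    (#|H|`_2 * 2 ^ k <= #|P|)%N.
  move=> HHH dv; rewrite (card_Sylow_part sylP (sHG H HHH)) leq_mul2l.
  apply/orP; right; rewrite p_part leq_exp2l //.
  by rewrite -pfactor_dvdn // indexg_gt0.
have part_eq (H : {group gT}) : H \in HH -> ~~ (4 %| #|G : H|%g)%N ->
    (#|H|`_2 * 2 = #|P|)%N.
  move=> HHH ndv; rewrite (card_Sylow_part sylP (sHG H HHH)); congr (_ * _)%N.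
  rewrite p_part; move: (dvd2 H HHH) ndv.
  rewrite -[4%N]/(2 ^ 2)%N -{1}[2%N]expn1 !pfactor_dvdn ?indexg_gt0 // -ltnNge.
  by case: (logn _ _) => [|[|]].
have [H1 HH1 ndv1]: exists2 H, H \in HH & ~~ (4 %| #|G : H|%g)%N.
  have [/existsP[H /andP[]]|] := boolP [exists H, (H \in HH) && ~~ (4 %| #|G : H|%g)%N].
    by exists H.
  rewrite negb_exists => /forallP all4.
  suff : (4 %| dG G HH)%N by rewrite dG2.
  apply/dvdn_biggcdP=> H HHH; have := all4 H; rewrite HHH /=.
  by rewrite negbK.
have [a1 Ga1 oS1] := Sylow_conjI_exists sylP (sHG H1 HH1).
have [x1 Dx1] := stab_pt H1 a1 HH1 Ga1.
have iM1 : (#|pstab s P x1| * 2 = #|P|)%N by rewrite Dx1 oS1 part_eq.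
have sMP : {in P &, {morph s : x y / (x * y)%g}}.
  by move=> x y /PG + /PG; apply: sM.
have nofix x : pstab s P x != P.
  have [H [a [HHH _ ->]]] := pt_stab x; apply/eqP=> oP.
  have := card_Sylow_conjI sylP H a; rewrite oP => leP.
  have := leq_trans (part_ge 1%N H HHH (dvd2 H HHH)) leP.
  by rewrite expn1 muln2 -addnn -[X in (_ <= X)%N]addn0 leq_add2l leqNgt part_gt0.
pose S x := Group (pstab_group_set sMP x).
(* Two stabilizers of full Sylow order, from distinct members of a special set, generate [P],
   whichever order of the pair speciality provides. *)
have special_not_sub (HH0 : {set {group gT}}) (H H' M : {group gT}) a b :
    HH0 \subset HH -> special G HH0 -> H \in HH0 -> H' \in HH0 -> H != H' ->
    a \in G -> b \in G ->
    #|P :&: (H :^ a)%g| = (#|H|`_2)%N -> #|P :&: (H' :^ b)%g| = (#|H'|`_2)%N ->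
    ~~ (P \subset M) ->
    ~~ ((P :&: (H :^ a)%g \subset M) && (P :&: (H' :^ b)%g \subset M)).
  move=> /subsetP sHH [_ _ spec] HH0H HH0H' neqH Ga Gb oS oS'; apply: contra.
  case/andP=> sS sS'.
  have [sH sH'] := (sHG H (sHH _ HH0H), sHG H' (sHH _ HH0H')).
  case: (spec H H' HH0H HH0H' neqH) => DG.
    exact: (Sylow_core_mul sylP sH sH' DG Ga Gb oS' sS sS').
  exact: (Sylow_core_mul sylP sH' sH DG Gb Ga oS sS' sS).
have nPS x : ~~ (P \subset S x).
  apply: contra (nofix x) => sPS; rewrite eqEsubset sPS andbT.
  exact: pstab_sub.
apply: (aug_kernel_no_resolution pP sMP _ iota_inj iota_im nofix iM1 _ resP).
  by move=> g Pg; rewrite -sE ?PG // iotaE ?PG.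
move=> x2 iM2.
case: cases => [[oHH [spec [Hb HHb dv4]]] | [_ [HH0 sHH0 [oHH0 spec]]]].
  have [b Gb oSb] := Sylow_conjI_exists sylP (sHG Hb HHb).
  have [x Dx] := stab_pt Hb b HHb Gb; exists x.
  (* A stabilizer of index 2 comes from some [H] of index not divisible by 4, hence different from
     [Hb], and has full Sylow order. *)
  have not_sub z : (#|pstab s P z| * 2 = #|P|)%N ->
      ~~ (pstab s P x \subset pstab s P z).
    move=> iz; have [H [a [HHH Ga Dz]]] := pt_stab z.
    have leH : (#|P| <= #|H|`_2 * 2)%N.
      by rewrite -iz Dz leq_mul2r (card_Sylow_conjI sylP).
    have ndvH : ~~ (4 %| #|G : H|%g)%N.
      apply/negP=> dvH; have := leq_trans (part_ge 2%N H HHH dvH) leH.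
      by rewrite leq_pmul2l ?part_gt0.
    have neqH : H != Hb by apply: contraNneq ndvH => ->.
    have oSa : #|P :&: (H :^ a)%g| = (#|H|`_2)%N.
      by apply/eqP; rewrite -(eqn_pmul2r (ltn0Sn 1)) -Dz iz part_eq.
    have := special_not_sub HH H Hb (S z) a b (subxx _) spec HHH HHb neqH Ga Gb oSa oSb (nPS z).
    by rewrite -Dz subxx Dx.
  by rewrite !not_sub.
have /card_gt2P[Ka [Kb [Kc [[Ka0 Kb0 Kc0] [neqab neqbc neqca]]]]] := oHH0.
have HH0P := subsetP sHH0.
have [a Ga oa] := Sylow_conjI_exists sylP (sHG Ka (HH0P _ Ka0)).
have [b Gb ob] := Sylow_conjI_exists sylP (sHG Kb (HH0P _ Kb0)).
have [c Gc oc] := Sylow_conjI_exists sylP (sHG Kc (HH0P _ Kc0)).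
have [xa Da] := stab_pt Ka a (HH0P _ Ka0) Ga.
have [xb Db] := stab_pt Kb b (HH0P _ Kb0) Gb.
have [xc Dc] := stab_pt Kc c (HH0P _ Kc0) Gc.
(* Each proper subgroup [S z] contains at most one of the three stabilizers, so [S x1] and [S x2]
   together leave at least one of them uncontained. *)
have excl z : [/\ ~~ ((pstab s P xa \subset S z) && (pstab s P xb \subset S z)),
    ~~ ((pstab s P xb \subset S z) && (pstab s P xc \subset S z))
  & ~~ ((pstab s P xc \subset S z) && (pstab s P xa \subset S z))].
  by rewrite Da Db Dc; split; apply: (special_not_sub HH0).
have [[ab1 bc1 ca1] [ab2 bc2 ca2]] := (excl x1, excl x2).
case Ea: (~~ (pstab s P xa \subset S x1) && ~~ (pstab s P xa \subset S x2)).
  by exists xa.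
case Eb: (~~ (pstab s P xb \subset S x1) && ~~ (pstab s P xb \subset S x2)).
  by exists xb.
exists xc; move: Ea Eb ab1 bc1 ca1 ab2 bc2 ca2; rewrite /S /=.
do 6!case: (_ \subset _) => //.
Qed.
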